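(* Let $f:(0,\infty)\to\mathbb{R}$ be a convex or concave function, and let $f^*(t)=t f(1/t)$ for $t\in(0,\infty)$. Let $\varphi:\mathbb{R}^n\to[0,\infty)$ be a log-concave function, with $\varphi$, $\varphi^\circ$ and $f$ satisfying the standing regularity and integrability assumptions listed in the context. Then $$D_f(\varphi^\circ)=D_{f^*}(\varphi).$$
   Context: A function $\varphi:\mathbb{R}^n\to[0,\infty)$ is log-concave if $\varphi=e^{-\psi}$ with $\psi$ convex ($\psi:\mathbb{R}^n\to\mathbb{R}$); $\mathrm{supp}(\varphi)=\{x:\varphi(x)>0\}$. The dual function is $\varphi^\circ(x)=\inf_{y\in\mathbb{R}^n}\frac{e^{-\langle x,y\rangle}}{\varphi(y)}$, i.e. $\varphi^\circ=e^{-\mathcal{L}\psi}$ with $\mathcal{L}\psi(x)=\sup_{y}[\langle x,y\rangle-\psi(y)]$. For a convex or concave $g:(0,\infty)\to\mathbb{R}$, the $g$-divergence of a log-concave function $\varphi$ is $$D_g(\varphi)=\int_{\mathrm{supp}(\varphi)}\varphi\; g\!\left(\frac{e^{\langle\nabla\varphi,x\rangle/\varphi}}{\varphi^2}\,\det\left[\mathrm{Hess}(-\ln\varphi)\right]\right)dx.$$ Convention: $g(0)=\lim_{t\downarrow0}g(t)$ and $0\cdot\infty=0$. Standing assumptions (smoothness and integrability making all expressions meaningful): $\psi=-\ln\varphi$ is strictly convex; $\varphi$ and $\varphi^\circ$ are integrable and twice continuously differentiable on their supports; and the integrands defining $D_{f^*}(\varphi)$ and $D_f(\varphi^\circ)$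 are integrable. *)

(* Defs.v *)
From HB Require Import structures.
From mathcomp Require Import all_boot all_order all_algebra.
From mathcomp Require Import all_classical all_reals all_analysis.

Set Implicit Arguments.
Unset Strict Implicit.
Unset Printing Implicit Defensive.
Import Order.TTheory GRing.Theory Num.Theory.
Import numFieldNormedType.Exports.

Local Open Scope classical_set_scope.
Local Open Scope ring_scope.

(* R^n is 'rV[R]_n. The library has no Lebesgue measure on
   R^n: it is built below by iterating the product of the one-dimensional
   [lebesgue_measure] with itself, on the sigma-algebra generated by the
   coordinates, i.e. the Borel sigma-algebra. *)

Definition rV_display : measure_display -> measure_display.
Proof. exact. Qed.

Section measurable_rV.
Context (R : realType) (n : nat).

Let coords (i : 'I_n) (v : 'rV[R]_n) : measurableTypeR R := v ord0 i.

Let rV_set0 : g_sigma_preimage coords set0.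
Proof. exact: sigma_algebra0. Qed.

Let rV_setC A : g_sigma_preimage coords A -> g_sigma_preimage coords (~` A).
Proof. exact: sigma_algebraC. Qed.

Let rV_bigcup (F : _^nat) : (forall i, g_sigma_preimage coords (F i)) ->
  g_sigma_preimage coords (\bigcup_i (F i)).
Proof. exact: sigma_algebra_bigcup. Qed.

HB.instance Definition _ :=
  @isMeasurable.Build (rV_display default_measure_display)
    'rV[R]_n (g_sigma_preimage coords) rV_set0 rV_setC rV_bigcup.

End measurable_rV.

Lemma measurable_rVcoord (R : realType) n (i : 'I_n) :
  measurable_fun [set: 'rV[R]_n] (fun v => v ord0 i : measurableTypeR R).
Proof.
move=> _ Y mY; rewrite setTI; apply: sub_sigma_algebra => /=.
rewrite -bigcup_seq/=; exists i => /=; first by rewrite mem_index_enum.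
by exists Y => //; rewrite setTI.
Qed.

Lemma measurable_fun_rVP (R : realType) n d (T : measurableType d)
    (f : T -> 'rV[R]_n) :
  (forall i, measurable_fun [set: T] (fun t => f t ord0 i : measurableTypeR R)) ->
  measurable_fun [set: T] f.
Proof.
move=> mf _ A mA; rewrite setTI.
suff : g_sigma_preimage (fun i (v : 'rV[R]_n) => v ord0 i : measurableTypeR R)
    `<=` [set B | measurable (f @^-1` B)] by apply.
apply: smallest_sub.
  split => /=.
  - by rewrite preimage_set0.
  - by move=> B mB; rewrite setTD preimage_setC; exact: measurableC.
  - by move=> F mF; rewrite preimage_bigcup; exact: bigcup_measurable.
rewrite -bigcup_seq/= => B [i _ [C mC <-]] /=.
by rewrite setTI -[X in measurable X]setTI; exact: mf.
Qed.

Section lebesgue_measure_rV.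
Context (R : realType).

Definition rVcons n (p : measurableTypeR R * 'rV[R]_n) : 'rV[R]_n.+1 :=
  row_mx (p.1)%:M p.2.

Lemma rVcons0 n p : @rVcons n p ord0 ord0 = p.1.
Proof.
rewrite /rVcons mxE; case: splitP => // j _.
by rewrite mxE !ord1 eqxx mulr1n.
Qed.

Lemma rVconsS n p (i : 'I_n) : @rVcons n p ord0 (lift ord0 i) = p.2 ord0 i.
Proof.
rewrite /rVcons mxE; case: splitP => [j|j /=].
  by move=> ji; have := ltn_ord j; rewrite -ji.
by rewrite /bump/= !add1n => -[ij]; congr (p.2 _ _); exact: val_inj.
Qed.

Lemma measurable_rVcons n : measurable_fun [set: _] (@rVcons n).
Proof.
apply: measurable_fun_rVP => i; case: (unliftP ord0 i) => [j|] ->.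
  under eq_fun do rewrite rVconsS.
  exact: (measurableT_comp (measurable_rVcoord j) measurable_snd).
by under eq_fun do rewrite rVcons0; exact: measurable_fst.
Qed.

Definition rVuncons n (v : 'rV[R]_n.+1) : measurableTypeR R * 'rV[R]_n :=
  (v ord0 ord0, \row_i v ord0 (lift ord0 i)).

Lemma rVconsK n : cancel (@rVcons n) (@rVuncons n).
Proof.
move=> p; rewrite /rVuncons rVcons0 [RHS]surjective_pairing; congr pair.
by apply/rowP => i; rewrite mxE rVconsS.
Qed.

Lemma measurable_rVuncons n : measurable_fun [set: _] (@rVuncons n).
Proof.
apply: measurable_fun_pair; first exact: measurable_rVcoord.
apply: measurable_fun_rVP => i; under eq_fun do rewrite mxE.
exact: measurable_rVcoord.
Qed.

Section rVcons_measure.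
Context n (mu : {sigma_finite_measure set 'rV[R]_n -> \bar R}).

Definition rVcons_measure : set 'rV[R]_n.+1 -> \bar R :=
  pushforward (@lebesgue_measure R \x mu)%E (@rVcons n).

Let rVcons_measure0 : rVcons_measure set0 = 0%E.
Proof. by rewrite /rVcons_measure /pushforward preimage_set0 measure0. Qed.

Let rVcons_measure_ge0 A : (0 <= rVcons_measure A)%E.
Proof. by rewrite /rVcons_measure /pushforward; exact: measure_ge0. Qed.

Let rVcons_measure_sigma_additive : semi_sigma_additive rVcons_measure.
Proof.
move=> F mF tF mUF; rewrite /rVcons_measure /pushforward preimage_bigcup.
apply: measure_semi_sigma_additive.
- by move=> k; rewrite -[X in measurable X]setTI; exact: measurable_rVcons.
- apply/trivIsetP => /= i j _ _ ij; rewrite -preimage_setI.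
  by move/trivIsetP : tF => /(_ _ _ _ _ ij) ->//; rewrite preimage_set0.
- rewrite -preimage_bigcup -[X in measurable X]setTI.
  exact: measurable_rVcons.
Qed.

HB.instance Definition _ := isMeasure.Build _ _ _ rVcons_measure
  rVcons_measure0 rVcons_measure_ge0 rVcons_measure_sigma_additive.

Let rVcons_measure_sigma_finite : sigma_finite setT rVcons_measure.
Proof.
have /sigma_finiteP[F [TF ndF Foo]] := sigma_finiteT (@lebesgue_measure R).
have /sigma_finiteP[G [TG ndG Goo]] := sigma_finiteT mu.
exists (fun k => @rVuncons n @^-1` (F k `*` G k)).
  apply/esym; rewrite -subTset => v _.
  have [i _ Fi] : (\bigcup_i F i) (rVuncons v).1 by rewrite -TF.
  have [j _ Gj] : (\bigcup_i G i) (rVuncons v).2 by rewrite -TG.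
  exists (maxn i j) => //; split.
  - by move: Fi; exact/subsetPset/ndF/leq_maxl.
  - by move: Gj; exact/subsetPset/ndG/leq_maxr.
move=> k; have [mFk Fk] := Foo k; have [mGk Gk] := Goo k; split.
  rewrite -[X in measurable X]setTI; apply: measurable_rVuncons => //.
  exact: measurableX.
rewrite /rVcons_measure /pushforward -comp_preimage.
rewrite (_ : _ \o _ = id); last by apply/funext => p; exact: rVconsK.
by rewrite preimage_id product_measure1E// lte_mul_pinfty// ge0_fin_numE.
Qed.

HB.instance Definition _ := Measure_isSigmaFinite.Build _ _ _ rVcons_measure
  rVcons_measure_sigma_finite.

End rVcons_measure.

Fixpoint lebesgue_rV n : {sigma_finite_measure set 'rV[R]_n -> \bar R} :=
  if n is n'.+1 then rVcons_measure (@lebesgue_rV n') else \d_(0 : 'rV[R]_0).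

Lemma lebesgue_rV_box n (a b : 'rV[R]_n) : (forall i, a ord0 i <= b ord0 i) ->
  lebesgue_rV n [set v | forall i, a ord0 i <= v ord0 i <= b ord0 i] =
  (\prod_(i < n) (b ord0 i - a ord0 i))%:E.
Proof.
elim: n a b => [|n IH] a b ab.
  by rewrite big_ord0 /= diracE mem_set// => -[].
rewrite /= /rVcons_measure /pushforward.
pose a' : 'rV[R]_n := \row_i a ord0 (lift ord0 i).
pose b' : 'rV[R]_n := \row_i b ord0 (lift ord0 i).
set B := [set v : 'rV[R]_n | forall i, a' ord0 i <= v ord0 i <= b' ord0 i].
have mB : measurable B.
  rewrite (_ : B = \bigcap_(i in [set: 'I_n])
      ((fun v : 'rV[R]_n => v ord0 i : measurableTypeR R) @^-1`
        `[a' ord0 i, b' ord0 i])); last first.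
    apply/seteqP; split => v /= Bv; first by move=> i _ /=; rewrite in_itv/=.
    by move=> i; have := Bv i I; rewrite /= in_itv.
  apply: fin_bigcap_measurable => [|i _]; first exact: finite_finset.
  rewrite -[X in measurable X]setTI.
  exact: (@measurable_rVcoord R n i measurableT _ (measurable_itv _)).
rewrite (_ : _ @^-1` _ =
    (`[a ord0 ord0, b ord0 ord0] : set (measurableTypeR R)) `*` B); last first.
  apply/seteqP; split => -[x v] /=.
    move=> xv; split => [|i]; first by have := xv ord0; rewrite rVcons0 in_itv.
    by have := xv (lift ord0 i); rewrite rVconsS !mxE.
  rewrite in_itv/= => -[xab Bv] i; case: (unliftP ord0 i) => [j|] ->.
    by have := Bv j; rewrite rVconsS !mxE.
  by rewrite rVcons0.
rewrite product_measure1E//.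
rewrite IH => [|i]; last by rewrite !mxE.
rewrite big_ord_recl EFinM; congr (_ * _)%E; last first.
  by congr (_%:E); apply: eq_bigr => i _; rewrite !mxE.
rewrite [LHS](lebesgue_measure_itv `[a ord0 ord0, b ord0 ord0])/= lte_fin.
by have := ab ord0; rewrite le_eqVlt => /predU1P[->|->//]; rewrite ltxx subrr.
Qed.

End lebesgue_measure_rV.

Section log_concave_functions.
Context (R : realType) (n : nat).
Implicit Types (x y : 'rV[R]_n) (phi psi : 'rV[R]_n -> R) (g : R -> R).

Definition dot x y : R := \sum_i x ord0 i * y ord0 i.

Definition partial (i : 'I_n) phi : 'rV[R]_n -> R := 'D_(delta_mx ord0 i) phi.

Definition grad phi x : 'rV[R]_n := \row_i partial i phi x.

Definition Hess phi x : 'M[R]_n := \matrix_(i, j) partial i (partial j phi) x.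

(* C^2 on A is understood on the interior of A. The support of a dual function
   is convex but need not be open; its boundary is Lebesgue-null. *)
Definition C2_on (A : set 'rV[R]_n) phi := forall x, A° x ->
  {for x, continuous phi} /\
  (forall i, derivable phi x (delta_mx ord0 i) /\
             {for x, continuous (partial i phi)}) /\
  (forall i j, derivable (partial j phi) x (delta_mx ord0 i) /\
               {for x, continuous (partial i (partial j phi))}).

Definition strictly_convex psi := forall (t : R) x y,
  0 < t < 1 -> x != y ->
  psi (t *: x + (1 - t) *: y) < t * psi x + (1 - t) * psi y.

Definition log_concave phi := exists2 psi,
  convex_function [set: 'rV[R]_n] psi & phi = (fun x => expR (- psi x)).

Definition supp phi : set 'rV[R]_n := [set x | 0 < phi x].

(* A real infimum: for log-concave phi, phi y > 0 for all y, so the set is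
   nonempty and bounded below by 0. *)
Definition dual phi x : R :=
  inf [set expR (- dot x y) / phi y | y in [set: 'rV[R]_n]].

(* g is only meaningful on ]0, +oo[; its value at 0 is its limit from the
   right, which may be infinite. Negative arguments never occur where phi is C^2
   and log-concave. *)
Definition ext0 g (t : R) : \bar R :=
  if 0 < t then (g t)%:E else lim ((g s)%:E @[s --> 0^'+]).

Definition divergence_integrand g phi x : \bar R :=
  ((phi x)%:E *
   ext0 g (expR (dot (grad phi x) x / phi x) / phi x ^+ 2
           * \det (Hess (fun y => (- ln (phi y))%R) x)))%E.

Definition divergence g phi : \bar R :=
  (\int[lebesgue_rV R n]_(x in supp phi) divergence_integrand g phi x)%E.

End log_concave_functions.

Definition convex_pos (R : realType) (f : R -> R) :=
  @convex_function R R^o `]0, +oo[ f.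

Definition concave_pos (R : realType) (f : R -> R) :=
  convex_pos (fun t => - f t).

Definition fstar (R : realType) (f : R -> R) (t : R) : R := t * f t^-1.

(* Main.v *)
From HB Require Import structures.
Require Import Defs.
From mathcomp Require Import all_boot all_order all_algebra.
From mathcomp Require Import all_classical all_reals all_analysis.
From mathcomp Require Import fingroup perm measurable_realfun ring lra.

(** Write [phi = exp (- psi)] with [psi] strictly convex and of class C^2 on R^n,
    let [psi^*] be the conjugate of [psi], so that the dual function is
    [exp (- psi^* )], and let [U] be the interior of the domain of [psi^*], that
    is, of the support of the dual function. The identity is the change of
    variables [y = grad psi x].

    By Legendre duality [grad psi] is a bijection from R^n onto [U], with inverse
    [grad psi^*] ([grad_interior], [grad_surjective], [grad_conj_gradK]). Both
    gradients are of class C^1 by assumption, so the two Hessians at corresponding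
    points are inverse matrices; since the Hessian of [psi] is positive
    semidefinite, its determinant is positive ([psd_det_gt0]) and the value of [f]
    or [fstar f] at 0 is never taken. The Fenchel-Young equality
    [psi x + psi^* y = <x, y>] then shows that the arguments of [fstar f] at [x]
    and of [f] at [y] are inverse to each other and that the integrand for
    [phi] at [x] is the integrand for the dual function at [y] times the Jacobian
    determinant ([integrand_grad]).

    What lies outside [U] in the support of the dual function is contained in the
    boundary of a convex set and is Lebesgue-null ([convex_boundary_null]): a
    homothety of ratio slightly less than 1 centred at an interior point sends the
    set into its interior and hardly changes volumes.

    The change of variables formula for Lebesgue measure on R^n
    ([ge0_change_of_variables]) is obtained in three steps. First, an invertible
    matrix multiplies volumes by the absolute value of its determinant
    ([scales_lebesgue_unitmx]). Next, continuous partial derivatives give strict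
    differentiability, for the map and for its inverse, hence two-sided estimates
    of the volume of the image of a small box near any point, with relative error
    as small as desired. Finally, a bisection argument ([box_bisection]) extends
    these estimates to all boxes, so that the volume of the image and the integral
    of the Jacobian agree on boxes, hence on Borel sets. *)

Set Implicit Arguments.
Unset Strict Implicit.
Unset Printing Implicit Defensive.
Import Order.TTheory GRing.Theory Num.Theory.
Import numFieldNormedType.Exports.
Local Open Scope classical_set_scope.
Local Open Scope ring_scope.

(** * Boxes and the Borel sigma-algebra of R^n *)

Section boxes.
Context (R : realType).

(** Boxes half-open on the same side in every coordinate are stable under
    intersection, and cutting one by a coordinate hyperplane gives two disjoint
    boxes of the same kind, so that they serve both as a pi-system and in the
    bisection argument below. *)
Definition obox n (a b : 'rV[R]_n) : set 'rV[R]_n :=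
  [set v | forall i, a ord0 i < v ord0 i <= b ord0 i].

Lemma measurable_rV_prod n (A : 'I_n -> set (measurableTypeR R)) :
  (forall i, measurable (A i)) ->
  measurable [set v : 'rV[R]_n | forall i, A i (v ord0 i)].
Proof.
move=> mA; rewrite (_ : mkset _ = \bigcap_(i in [set: 'I_n])
    ((fun v : 'rV[R]_n => v ord0 i : measurableTypeR R) @^-1` A i)); last first.
  by apply/seteqP; split => v /= Av; [move=> i _; exact: Av|move=> i; exact: (Av i I)].
apply: fin_bigcap_measurable => [|i _]; first exact: finite_finset.
by rewrite -[X in measurable X]setTI; exact: (@measurable_rVcoord R n i).
Qed.

Lemma lebesgue_rV_prod n (A : 'I_n -> set (measurableTypeR R)) :
  (forall i, measurable (A i)) ->
  lebesgue_rV R n [set v | forall i, A i (v ord0 i)] =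
  (\prod_(i < n) lebesgue_measure (A i))%E.
Proof.
elim: n A => [|n IH] A mA.
  by rewrite big_ord0 /= diracE mem_set// => -[].
rewrite /= /rVcons_measure /pushforward.
pose A' i := A (lift ord0 i).
have mA' : measurable [set v : 'rV[R]_n | forall i, A' i (v ord0 i)].
  by apply: measurable_rV_prod => i; exact: mA.
rewrite (_ : _ @^-1` _ = A ord0 `*` [set v : 'rV[R]_n | forall i, A' i (v ord0 i)]).
  by rewrite product_measure1E// (IH A' (fun i => mA _)) big_ord_recl.
apply/seteqP; split => -[x v] /=.
  move=> xv; split => [|i]; first by have := xv ord0; rewrite rVcons0.
  by have := xv (lift ord0 i); rewrite rVconsS.
move=> [xA vA] i; case: (unliftP ord0 i) => [j|] ->; last by rewrite rVcons0.
by rewrite rVconsS; exact: vA.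
Qed.

Lemma obox_prod n (a b : 'rV[R]_n) :
  obox a b = [set v | forall i, `]a ord0 i, b ord0 i]%classic (v ord0 i)].
Proof.
by apply/seteqP; split => v vab i; have := vab i; rewrite /= in_itv.
Qed.

Lemma measurable_obox n (a b : 'rV[R]_n) : measurable (obox a b).
Proof.
rewrite obox_prod.
exact: (@measurable_rV_prod n (fun i => `]a ord0 i, b ord0 i]%classic)
  (fun i => measurable_itv _)).
Qed.

Lemma lebesgue_rV_obox n (a b : 'rV[R]_n) : (forall i, a ord0 i <= b ord0 i) ->
  lebesgue_rV R n (obox a b) = (\prod_(i < n) (b ord0 i - a ord0 i))%:E.
Proof.
move=> ab; rewrite obox_prod.
rewrite (@lebesgue_rV_prod n (fun i => `]a ord0 i, b ord0 i]%classic)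
  (fun i => measurable_itv _)) -prodEFin.
apply: eq_bigr => i _; rewrite lebesgue_measure_itv/= lte_fin.
by have := ab i; rewrite le_eqVlt => /predU1P[->|->//]; rewrite ltxx subrr.
Qed.

Lemma obox_setI n (a b a' b' : 'rV[R]_n) :
  obox a b `&` obox a' b' =
  obox (\row_i Num.max (a ord0 i) (a' ord0 i))
       (\row_i Num.min (b ord0 i) (b' ord0 i)).
Proof.
apply/seteqP; split => v /= => [[va va'] i|vab].
  by rewrite !mxE gt_max le_min; have /andP[-> ->] := va i; have /andP[-> ->] := va' i.
by split=> i; have := vab i; rewrite !mxE gt_max le_min => /andP[/andP[? ?] /andP[? ?]]; apply/andP.
Qed.

Lemma rV_norm_coord n (v : 'rV[R]_n) i : `|v ord0 i| <= `|v|.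
Proof.
by rewrite [leRHS]/Num.norm/= mx_normrE; apply/bigmax_geP; right => /=; exists (ord0, i).
Qed.

Lemma obox_cover n :
  \bigcup_k obox (const_mx (- k%:R)) (const_mx k%:R) = [set: 'rV[R]_n].
Proof.
rewrite -subTset => v _; exists (Num.truncn (`|v| : R)).+1 => // i.
have vi := rV_norm_coord v i.
have := truncnS_gt `|v|; rewrite !mxE => vk.
by have := le_lt_trans vi vk; rewrite ltr_norml => /andP[-> /ltW].
Qed.

(** The half-space where the [i]-th coordinate exceeds [x] is the increasing
    union over [k] of the boxes whose [i]-th side is [`]x, k]] and whose other
    sides are [`]-k, k]]. *)
Lemma measurable_rV_obox n :
  @measurable _ 'rV[R]_n = <<s [set obox x.1 x.2 | x in [set: 'rV[R]_n * 'rV[R]_n]] >>.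
Proof.
apply/seteqP; split; last first.
  apply: smallest_sub; first exact: sigma_algebra_measurable.
  by move=> _ [x _ <-]; exact: measurable_obox.
apply: smallest_sub; first exact: smallest_sigma_algebra.
rewrite -bigcup_seq => _ [/= i _] [B mB <-].
pose G := [set obox x.1 x.2 | x in [set: 'rV[R]_n * 'rV[R]_n]].
pose c := (fun v : g_sigma_algebraType G => v ord0 i : measurableTypeR R).
suff : measurable_fun [set: g_sigma_algebraType G] c by move=> /(_ measurableT B mB).
apply: (measurability _ (RGenOInfty.measurableE R)) => _ [_ [x ->] <-].
rewrite setTI (_ : _ @^-1` _ =
    \bigcup_k obox (\row_j if j == i then x else - k%:R) (const_mx k%:R)).
  apply: bigcup_measurable => k _; apply: sub_sigma_algebra.
  by exists ((\row_j if j == i then x else - k%:R), (const_mx k%:R)).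
apply/seteqP; split => v /=.
  rewrite in_itv/= andbT => xv.
  have [k _ vk] : (\bigcup_k obox (const_mx (- k%:R)) (const_mx k%:R)) v by rewrite obox_cover.
  exists k => // j; have := vk j; rewrite !mxE; case: eqP => // -> /andP[_ ->].
  by rewrite xv.
by move=> [k _ /(_ i)]; rewrite !mxE eqxx in_itv/= andbT => /andP[].
Qed.

Lemma le_lebesgue_rV n (A B : set 'rV[R]_n) : measurable A -> measurable B ->
  A `<=` B -> (lebesgue_rV R n A <= lebesgue_rV R n B)%E.
Proof. by move=> mA mB AB; apply: le_measure; rewrite ?mem_set. Qed.

Lemma obox_eq0 n (a b : 'rV[R]_n) i : b ord0 i <= a ord0 i -> obox a b = set0.
Proof.
move=> ba; apply/seteqP; split => // v /(_ i) /andP[av vb].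
by have := lt_le_trans av (le_trans vb ba); rewrite ltxx.
Qed.

(** Dynkin's pi-lambda theorem for boxes; boxes with an empty side have measure
    zero and need no checking. *)
Lemma eq_measure_rV n (m1 m2 : {measure set 'rV[R]_n -> \bar R}) :
  (forall a b : 'rV[R]_n, (forall i, a ord0 i < b ord0 i) ->
     m1 (obox a b) = m2 (obox a b) /\ (m1 (obox a b) < +oo)%E) ->
  forall A, measurable A -> m1 A = m2 A.
Proof.
move=> m12.
have {}m12 a b : m1 (obox a b) = m2 (obox a b) /\ (m1 (obox a b) < +oo)%E.
  have [ab|] := pselect (forall i, a ord0 i < b ord0 i); first exact: m12.
  by move=> /existsNP[i /negP]; rewrite -leNgt => /obox_eq0 ->; rewrite !measure0.
apply: (measure_unique [set obox x.1 x.2 | x in [set: 'rV[R]_n * 'rV[R]_n]]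
  (fun k => obox (const_mx (- k%:R)) (const_mx k%:R))).
- exact: measurable_rV_obox.
- move=> _ _ [[a b] _ <-] [[a' b'] _ <-] /=; rewrite obox_setI.
  by eexists (_, _); [exact: I|rewrite /=; reflexivity].
- by move=> i; exists (const_mx (- i%:R), const_mx i%:R).
- exact: obox_cover.
- by move=> _ [[a b] _ <-]; exact: (m12 _ _).1.
- by move=> k; exact: (m12 _ _).2.
Qed.

Lemma rV_norm_ltP n (v : 'rV[R]_n) e : 0 < e ->
  (forall i, `|v ord0 i| < e) <-> `|v| < e.
Proof.
move=> e0; split => [ve|ve i]; last exact: le_lt_trans (rV_norm_coord _ _) ve.
rewrite [ltLHS]/Num.norm /= mx_normrE; apply/bigmax_ltP; split => // -[i j] _ /=.
by rewrite (ord1 i).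
Qed.

Lemma rV_norm_leP n (v : 'rV[R]_n) e : 0 <= e ->
  (forall i, `|v ord0 i| <= e) <-> `|v| <= e.
Proof.
move=> e0; split => [ve|ve i]; last exact: le_trans (rV_norm_coord _ _) ve.
rewrite [leLHS]/Num.norm /= mx_normrE; apply/bigmax_leP; split => // -[i j] _ /=.
by rewrite (ord1 i).
Qed.

(** In the sup norm an open set is the union of the cubes with rational centre
    and rational radius that it contains. *)
Lemma open_measurable_rV n (U : set 'rV[R]_n) : open U -> measurable U.
Proof.
move=> oU.
pose B (c : 'rV[rat]_n * rat) := [set v : 'rV[R]_n | forall i,
   `|v ord0 i - ratr (c.1 ord0 i)| < ratr c.2].
pose F c := [set v | B c v /\ B c `<=` U].
rewrite (_ : U = \bigcup_c F c).
  apply: countable_bigcupT_measurable => [|c]; first exact: countableP.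
  have [BU|BU] := pselect (B c `<=` U); last first.
    by rewrite (_ : F c = set0)//; apply/seteqP; split => // v [].
  rewrite (_ : F c = B c); last by apply/seteqP; split => // v [].
  rewrite (_ : B c = [set v | forall i, `](ratr (c.1 ord0 i) - ratr c.2),
      (ratr (c.1 ord0 i) + ratr c.2)[%classic (v ord0 i)]).
    exact: (@measurable_rV_prod n (fun i => `](ratr (c.1 ord0 i) - ratr c.2),
      (ratr (c.1 ord0 i) + ratr c.2)[%classic) (fun i => measurable_itv _)).
  by apply/seteqP; split => v Bv i; have := Bv i; rewrite /= in_itv/= -ltr_distl.
apply/seteqP; split => [v Uv|v [c _ []]]; last by move=> Bv; exact.
have /nbhs_ballP[e /= e0 eU] : nbhs v U by apply: open_nbhs_nbhs.
have [q /[!in_itv]/= /andP[q0 qe]] := @rat_in_itvoo R 0 (e / 2) (divr_gt0 e0 (ltr0Sn _ 1)).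
have vq i : {p : rat | `|v ord0 i - ratr p| < ratr q}.
  apply: cid.
  have [|p] := @rat_in_itvoo R (v ord0 i - ratr q) (v ord0 i + ratr q); first by lra.
  by rewrite in_itv/= -ltr_distl distrC => ?; exists p.
exists (\row_i sval (vq i), q) => //; split => [i|u Bu].
  by rewrite /= mxE; exact: (svalP (vq i)).
apply: eU; rewrite -ball_normE /ball_ /=; apply/rV_norm_ltP => // i.
rewrite !mxE; have /= := Bu i; rewrite mxE; have := svalP (vq i).
set p := ratr _; move=> vp up.
rewrite (_ : v ord0 i - u ord0 i = (v ord0 i - p) - (u ord0 i - p)); last by ring.
by apply: le_lt_trans (ler_normB _ _) _; lra.
Qed.

Lemma open_continuous_measurable_rV n (U : set 'rV[R]_n) (f : 'rV[R]_n -> R) :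
  open U -> (forall x, U x -> {for x, continuous f}) ->
  measurable_fun U (f : _ -> measurableTypeR R).
Proof.
move=> oU cf; apply: (measurability _ (RGenOpens.measurableE R)).
move=> _ [_ [a [b ->] <-]]; apply: open_measurable_rV.
rewrite openE => x [Ux fx]; rewrite /interior; apply: filterI.
  exact: open_nbhs_nbhs.
by apply: cf => //; apply: open_nbhs_nbhs; split => //; exact: interval_open.
Qed.

End boxes.

(** * Linear maps and Lebesgue measure *)

Section linear_maps.
Context (R : realType).
Local Notation lam n := (lebesgue_rV R n).

(** To compute how a map of R^n rescales Lebesgue measure it suffices to test
    boxes. *)
Lemma eq_pushforward_rV n (c : R) (h : 'rV[R]_n -> 'rV[R]_n) : 0 <= c ->
  measurable_fun [set: 'rV[R]_n] h ->
  (forall a b : 'rV[R]_n, (forall i, a ord0 i < b ord0 i) ->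
     (c%:E * lam n (h @^-1` obox a b) = lam n (obox a b))%E) ->
  forall A, measurable A -> (c%:E * lam n (h @^-1` A) = lam n A)%E.
Proof.
move=> c0 mh hbox A mA.
pose hlam : {measure set 'rV[R]_n -> \bar R} :=
  measure_function_pushforward__canonical__measure_function_Measure (lam n) mh.
rewrite -[LHS]/(mscale (NngNum c0) hlam A).
apply/esym; apply: (@eq_measure_rV _ _ (lam n) (mscale (NngNum c0) hlam)) => // a b ab.
split; first exact/esym/hbox.
by have := lebesgue_rV_obox (fun i => ltW (ab i)) => /= ->; rewrite ltry.
Qed.

Lemma measurable_rVD n (c : 'rV[R]_n) :
  measurable_fun [set: 'rV[R]_n] (fun v => v + c).
Proof.
apply: measurable_fun_rVP => i; under eq_fun do rewrite mxE.
by apply: measurable_funD => //; exact: measurable_rVcoord.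
Qed.

Lemma lebesgue_rVD n (c : 'rV[R]_n) A : measurable A ->
  lam n ((fun v => v + c) @^-1` A) = lam n A.
Proof.
move=> mA; rewrite -[LHS]mul1e -[RHS](@eq_pushforward_rV n 1 (fun v => v + c))//.
  exact: measurable_rVD.
move=> a b ab; rewrite mul1e (_ : _ @^-1` _ = obox (a - c) (b - c)); last first.
  by apply/seteqP; split => v /= vab i; have := vab i; rewrite !mxE ltrBlDr lerBrDr.
rewrite !lebesgue_rV_obox => [|i|i]; [|by rewrite ltW|by rewrite !mxE lerD2r ltW].
by congr (_%:E); apply: eq_bigr => i _; rewrite !mxE; ring.
Qed.

Lemma measurable_mulmx n m (A : 'M[R]_(n, m)) :
  measurable_fun [set: 'rV[R]_n] (fun v => v *m A).
Proof.
apply: measurable_fun_rVP => i; under eq_fun do rewrite mxE.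
apply: measurable_sum => j; apply: measurable_funM => //.
exact: measurable_rVcoord.
Qed.

Lemma measurable_affine_preimage n (c : 'rV[R]_n) (A : 'M[R]_n) (E : set 'rV[R]_n) :
  measurable E -> measurable ((fun v => (v - c) *m A) @^-1` E).
Proof.
move=> mE; rewrite -[X in measurable X]setTI.
exact: (measurableT_comp (measurable_mulmx A) (measurable_rVD (- c))).
Qed.

(** Vectors are rows, so the linear map of [A] is [v |-> v *m A]. Using the
    preimage avoids inverse matrices and makes stability under products
    immediate. *)
Definition scales_lebesgue n (A : 'M[R]_n) := forall E, measurable E ->
  (`|\det A|%:E * lam n ((fun v => v *m A) @^-1` E) = lam n E)%E.

Lemma scales_lebesgue_mul n (A B : 'M[R]_n) :
  scales_lebesgue A -> scales_lebesgue B -> scales_lebesgue (A *m B).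
Proof.
move=> hA hB E mE; rewrite det_mulmx normrM EFinM [(_ * `|\det B|%:E)%E]muleC -muleA.
rewrite (_ : _ @^-1` _ = (fun v => v *m A) @^-1` ((fun v => v *m B) @^-1` E)); last first.
  by apply/funext => v /=; rewrite mulmxA.
rewrite hA ?hB//; rewrite -[X in measurable X]setTI.
exact: measurable_mulmx.
Qed.

Lemma scales_lebesgue_perm n (s : 'S_n) : scales_lebesgue (perm_mx s).
Proof.
move=> E mE; rewrite det_perm normrX normrN1 expr1n.
apply: eq_pushforward_rV => // [|a b ab]; first exact: measurable_mulmx.
rewrite mul1e (_ : _ @^-1` _ = obox (col_perm s a) (col_perm s b)); last first.
  have vE (v : 'rV[R]_n) : v *m perm_mx s = col_perm s^-1%g v.
    by rewrite col_permE invgK.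
  apply/seteqP; split => v /=; rewrite vE => vab i.
    by have := vab (s i); rewrite !mxE permK.
  by have := vab (s^-1%g i); rewrite !mxE permKV.
rewrite !lebesgue_rV_obox => [|i|i]; [|by rewrite ltW|by rewrite !mxE ltW].
congr (_%:E); rewrite [RHS](reindex_inj (@perm_inj _ s)).
by apply: eq_bigr => i _; rewrite !mxE.
Qed.

(** The preimage of a box is a product of intervals, whose sides are open on
    the left or on the right according to the sign of the diagonal entry. *)
Lemma scales_lebesgue_diag n (d : 'rV[R]_n) : (forall i, d ord0 i != 0) ->
  scales_lebesgue (diag_mx d).
Proof.
move=> d0 E mE; rewrite det_diag normr_prod.
apply: eq_pushforward_rV => // [||a b ab]; [exact: prodr_ge0|exact: measurable_mulmx|].
pose I i : set (measurableTypeR R) := if 0 < d ord0 i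
  then `](a ord0 i / d ord0 i), (b ord0 i / d ord0 i)]%classic
  else `[(b ord0 i / d ord0 i), (a ord0 i / d ord0 i)[%classic.
rewrite (_ : _ @^-1` _ = [set v : 'rV[R]_n | forall i, I i (v ord0 i)]); last first.
  have H (v : 'rV[R]_n) i : (a ord0 i < (v *m diag_mx d) ord0 i <= b ord0 i) <-> I i (v ord0 i).
    rewrite mul_mx_diag mxE /I; case: (ltgtP 0 (d ord0 i)) (d0 i) => // di _ /=; rewrite in_itv/=.
      by rewrite ltr_pdivrMr// ler_pdivlMr.
    by rewrite ltr_ndivlMr// ler_ndivrMr// andbC.
  by apply/seteqP; split => v /= vab i; have /H := vab i.
rewrite lebesgue_rV_prod => [|i]; last by rewrite /I; case: ifP.
have lamI i : lebesgue_measure (I i) = ((b ord0 i - a ord0 i) / `|d ord0 i|)%:E.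
  rewrite /I; case: (ltgtP 0 (d ord0 i)) (d0 i) => // di _.
    rewrite lebesgue_measure_itv/= lte_fin ltr_pM2r ?invr_gt0// ab gtr0_norm//.
    by rewrite mulrBl.
  rewrite lebesgue_measure_itv/= lte_fin ltr_nM2r ?invr_lt0// ab ltr0_norm//.
  by rewrite invrN mulrN mulrBl opprB.
rewrite (eq_bigr _ (fun i _ => lamI i)) prodEFin -EFinM -big_split/=.
rewrite lebesgue_rV_obox => [|i]; last exact/ltW.
congr (_%:E); apply: eq_bigr => i _.
by rewrite mulrCA divff ?mulr1// normr_eq0.
Qed.

(** The map is [(x, w) |-> (x, x r + w A)]: its restriction to the fibre over
    [x] is [A] followed by a translation, so Fubini in the first coordinate
    gives the result. *)
Lemma scales_lebesgue_ublock n (r : 'rV[R]_n) (A : 'M[R]_n) : \det A = 1 ->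
  scales_lebesgue A -> scales_lebesgue (block_mx (1%:M : 'M[R]_1) r (0 : 'cV[R]_n) A).
Proof.
move=> detA hA E mE; rewrite (@det_ublock _ 1 n) det1 detA mul1r normr1 mul1e.
rewrite /= /rVcons_measure /pushforward /product_measure1.
apply: eq_integral => x _ /=.
pose E' := xsection (@rVcons R n @^-1` E) x.
have mE' : measurable E'.
  apply: measurable_xsection; rewrite -[X in measurable X]setTI.
  exact: measurable_rVcons.
rewrite -/E' -(@lebesgue_rVD _ (x *: r) E')//.
set E2 := (fun v => v + x *: r) @^-1` E'.
have mE2 : measurable E2.
  by rewrite -[X in measurable X]setTI; exact: measurable_rVD.
have := hA _ mE2; rewrite detA normr1 mul1e => hAE2.
rewrite -hAE2; congr (lebesgue_rV R n _).
have mulE (w : 'rV[R]_n) : rVcons (x, w) *m block_mx (1%:M : 'M[R]_1) r 0 A =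
    rVcons (x, w *m A + x *: r).
  by rewrite /rVcons/= (@mul_row_block _ 1 1 n 1 n) mulmx1 mulmx0 addr0 mul_scalar_mx addrC.
apply/seteqP; split => w.
  by move=> /xsectionP/= xw; apply/xsectionP; rewrite /= -mulE.
by move=> /xsectionP/= xw; apply/xsectionP; rewrite /= mulE.
Qed.

Definition unitriangular n (A : 'M[R]_n) :=
  forall i j : 'I_n, (j <= i)%N -> A i j = (i == j)%:R.

Lemma unitriangular_det n (A : 'M[R]_n) : unitriangular A -> \det A = 1.
Proof.
move=> uA; rewrite -det_tr det_trig.
  by rewrite big1// => i _; rewrite mxE uA// eqxx.
apply/is_trig_mxP => i j ij; rewrite mxE (uA _ _ (ltnW ij)).
by rewrite (_ : (j == i) = false)//; exact: gtn_eqF.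
Qed.

Lemma scales_lebesgue_unitriangular n (A : 'M[R]_n) : unitriangular A ->
  scales_lebesgue A.
Proof.
elim: n A => [|n IH] A uA.
  move=> E mE; rewrite det_mx00 normr1 mul1e; congr (lebesgue_rV R _ _).
  by apply/funext => v /=; rewrite [v *m A]thinmx0 [v]thinmx0.
rewrite -[A](@submxK _ 1 n 1 n).
have -> : @ulsubmx _ 1 n 1 n A = 1%:M.
  by apply/matrixP => i j; rewrite !ord1 !mxE uA// !eqxx.
have -> : @dlsubmx _ 1 n 1 n A = 0.
  by apply/matrixP => i j; rewrite !ord1 !mxE uA.
have u' : unitriangular (@drsubmx _ 1 n 1 n A).
  by move=> i j ji; rewrite !mxE uA.
by apply: scales_lebesgue_ublock; [exact: unitriangular_det|exact: IH].
Qed.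

(** By the LUP decomposition [A] is a product of a permutation matrix, a lower
    unitriangular matrix and an upper triangular one. The last is a diagonal
    matrix times an upper unitriangular one, and reversing the order of the
    coordinates exchanges lower and upper unitriangular matrices. *)
Lemma scales_lebesgue_unitmx n (A : 'M[R]_n) : A \in unitmx -> scales_lebesgue A.
Proof.
case: n A => [|n] A uA.
  by apply: scales_lebesgue_unitriangular => -[].
have := cormen_lup_correct A; have := cormen_lup_perm A.
have := cormen_lup_detL A; have := cormen_lup_lower A; have := cormen_lup_upper A.
case: cormen_lup => [[P L] U] /= Uu Ll detL /is_perm_mxP[s ->{P}] PA.
have detU : \det U != 0.
  move: (congr1 determinant PA); rewrite !det_mulmx detL mul1r => <-.
  by apply: mulf_neq0; rewrite -unitfE -unitmxE ?unitmx_perm.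
have detUE : \det U = \prod_i U i i.
  rewrite -det_tr det_trig; first by apply: eq_bigr => i _; rewrite mxE.
  by apply/is_trig_mxP => i j ij; rewrite mxE Uu.
have U0 i : U i i != 0.
  by apply: contra detU => /eqP Ui; rewrite detUE (bigD1 i)//= Ui mul0r.
pose d : 'rV[R]_n.+1 := \row_i U i i.
pose U1 := diag_mx (\row_i (U i i)^-1) *m U.
have UE : U = diag_mx d *m U1.
  rewrite mulmxA mulmx_diag (_ : diag_mx _ = 1%:M) ?mul1mx//.
  apply/matrixP => i j; rewrite !mxE; case: eqP => // _.
  by rewrite mulr1n divff.
have uU1 : unitriangular U1.
  move=> i j ji; rewrite /U1 mul_diag_mx !mxE.
  case: eqVneq => [<-|ij]; first by rewrite mulVf.
  have ji' : (j < i)%N by rewrite ltn_neqAle ji andbT eq_sym.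
  by rewrite (Uu i j) ?mulr0.
pose w : 'S_n.+1 := perm (@rev_ord_inj n.+1).
pose L1 := perm_mx w *m L *m perm_mx w.
have wK : perm_mx w *m perm_mx w = 1%:M :> 'M[R]_n.+1.
  rewrite -perm_mxM (_ : (w * w)%g = 1%g) ?perm_mx1//.
  by apply/permP => i; rewrite permM !permE rev_ordK.
have LE : L = perm_mx w *m L1 *m perm_mx w.
  by rewrite /L1 !mulmxA wK mul1mx -mulmxA wK mulmx1.
have uL1 : unitriangular L1.
  move=> i j ji.
  rewrite /L1 (_ : perm_mx w *m L *m perm_mx w =
     col_perm w (row_perm w L)); last first.
    rewrite col_permE row_permE; congr (_ *m perm_mx _).
    apply/permP => k; apply: (@perm_inj _ w); rewrite permKV.
    by rewrite !permE rev_ordK.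
  rewrite !mxE !permE Ll ?(inj_eq rev_ord_inj)// /=.
  by rewrite leq_sub2l.
have -> : A = perm_mx s^-1%g *m (L *m U).
  by rewrite [L *m U](esym PA) mulmxA -perm_mxM mulVg perm_mx1 mul1mx.
apply: scales_lebesgue_mul; first exact: scales_lebesgue_perm.
apply: scales_lebesgue_mul.
  rewrite LE; apply: scales_lebesgue_mul; last exact: scales_lebesgue_perm.
  apply: scales_lebesgue_mul; first exact: scales_lebesgue_perm.
  exact: scales_lebesgue_unitriangular.
rewrite UE; apply: scales_lebesgue_mul; last exact: scales_lebesgue_unitriangular.
by apply: scales_lebesgue_diag => i; rewrite mxE.
Qed.

(** The left-hand side is the measure of the image of [E] under
    [u |-> c + u *m A]. *)
Lemma lebesgue_rV_affine n (A : 'M[R]_n) (c : 'rV[R]_n) E : A \in unitmx ->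
  measurable E ->
  (lam n ((fun x => (x - c) *m invmx A) @^-1` E) = `|\det A|%:E * lam n E)%E.
Proof.
move=> uA mE.
pose E1 := (fun v => v *m invmx A) @^-1` E.
have mE1 : measurable E1.
  by rewrite -[X in measurable X]setTI; exact: measurable_mulmx.
rewrite -[LHS]/(lam n ((fun x => x + - c) @^-1` E1)) lebesgue_rVD//.
rewrite -(scales_lebesgue_unitmx uA mE1) /E1; congr (_ * lam n _)%E.
by apply/funext => v /=; rewrite mulmxK.
Qed.

End linear_maps.

(** * Strict differentiability *)

Section strict_differentiability.
Context (R : realType).

Lemma near_norm n (a : 'rV[R]_n) r : 0 < r -> \forall x \near a, `|x - a| < r.
Proof.
move=> r0; apply/nbhs_ballP; exists r => //= x.
by rewrite -ball_normE /ball_ /= distrC.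
Qed.

Lemma near_right_ex (P : R -> Prop) : (\forall d \near (0:R)^'+, P d) ->
  exists2 d : R, 0 < d & P d.
Proof.
move=> nP; near (0:R)^'+ => d; exists d; last by near: d.
by near: d; exact: nbhs_right_gt.
Unshelve. all: by end_near. Qed.

Lemma is_derive_line n (g : 'rV[R]_n -> R) (p v : 'rV[R]_n) (t : R) :
  derivable g (p + t *: v) v ->
  is_derive t (1 : R) (fun s => g (p + s *: v)) ('D_v g (p + t *: v)).
Proof.
move=> dg.
have E : (fun h : R => h^-1 *: (((fun s => g (p + s *: v)) \o shift t) (h *: (1 : R)) -
      g (p + t *: v))) =
    (fun h : R => h^-1 *: ((g \o shift (p + t *: v)) (h *: v) - g (p + t *: v))).
  apply/funext => h /=; congr (_ *: (g _ - _)).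
  by rewrite [h *: 1]mulr1 scalerDl addrCA.
by split; rewrite /derivable /derive E.
Qed.

(** The intermediate point is only located by [`|t| <= `|s|]; this is enough
    to keep it in a ball and avoids distinguishing the sign of [s]. *)
Lemma line_MVT n (g : 'rV[R]_n -> R) (p v : 'rV[R]_n) (s : R) :
  (forall t, `|t| <= `|s| -> derivable g (p + t *: v) v) ->
  exists2 t, `|t| <= `|s| & g (p + s *: v) - g p = s * 'D_v g (p + t *: v).
Proof.
move=> dg; pose h := fun s => g (p + s *: v).
have dh t : `|t| <= `|s| -> is_derive t (1 : R) h ('D_v g (p + t *: v)).
  by move=> /dg; exact: is_derive_line.
have ch a b : `|a| <= `|s| -> `|b| <= `|s| -> {within `[a, b], continuous h}.
  move=> sa sb; apply: derivable_within_continuous => t.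
  rewrite in_itv/= => /andP[at_ tb]; apply: (@ex_derive _ _ _ _ _ _ _ (dh t _)).
  move: sa sb; rewrite !ler_norml => /andP[? ?] /andP[? ?].
  by apply/andP; split; lra.
have [s0|s0] := leP 0 s.
  have [||c] := @MVT_segment R h (fun t => 'D_v g (p + t *: v)) 0 s s0.
  - move=> t; rewrite in_itv/= => /andP[t0 ts]; apply: dh.
    by rewrite (ger0_norm s0) (ger0_norm (ltW t0)) ltW.
  - by apply: ch; rewrite ?normr0.
  rewrite in_itv/= => /andP[c0 cs]; rewrite /h scale0r addr0 subr0 mulrC => ->.
  by exists c => //; rewrite !ger0_norm.
have [||c] := @MVT_segment R h (fun t => 'D_v g (p + t *: v)) s 0 (ltW s0).
- move=> t; rewrite in_itv/= => /andP[t0 ts]; apply: dh.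
  by rewrite !ltr0_norm// lerN2 ltW.
- by apply: ch; rewrite ?normr0.
rewrite in_itv/= => /andP[sc c0]; rewrite /h scale0r addr0 sub0r => E.
exists c; first by rewrite ler0_norm// ltr0_norm// lerN2.
by rewrite -[LHS]opprK opprB E; ring.
Qed.

(** Passing from [y] to [x] by changing one coordinate at a time, the increment
    of [g] telescopes into [n] increments along coordinate lines; by the mean
    value theorem each is a partial derivative at a point near [a], hence close
    to the partial derivative at [a]. *)
Lemma partial_strict n (g : 'rV[R]_n -> R) (a : 'rV[R]_n) :
  (\forall x \near a, forall i, derivable g x (delta_mx ord0 i)) ->
  (forall i, {for a, continuous (partial i g)}) ->
  forall e, 0 < e -> \forall d \near (0:R)^'+, forall x y, `|x - a| < d -> `|y - a| < d ->
    `|g x - g y - \sum_i (x - y) ord0 i * partial i g a| <= e * `|x - y|.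
Proof.
move=> dg cg e e0.
have e'0 : 0 < e / n.+1%:R by rewrite divr_gt0.
have : \forall x \near a, forall i, derivable g x (delta_mx ord0 i) /\
     `|partial i g x - partial i g a| <= e / n.+1%:R.
  near=> x => i; split; first by move: i; near: x.
  move: i; near: x; apply: filter_forall => i.
  by have /cvgrPdist_le/(_ _ e'0) := cg i; apply: filterS => x; rewrite distrC.
rewrite -nbhs_nearE => /nbhs_ballP[r /= r0 ar].
near=> d => x y xa ya.
have d0 : 0 < d by near: d; exact: nbhs_right_gt.
(* The points produced by the mean value theorem are within [2 * d] of points of
   the ball of radius [d]. *)
have dr : 3 * d < r.
  by rewrite mulrC -ltr_pdivlMr//; near: d; apply: nbhs_right_lt; rewrite divr_gt0.
pose p (k : nat) : 'rV[R]_n := \row_i if (i < k)%N then x ord0 i else y ord0 i.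
have pn : p n = x by apply/rowP => i; rewrite mxE ltn_ord.
have p0 : p 0%N = y by apply/rowP => i; rewrite mxE.
have pS (k : 'I_n) : p k.+1 = p k + (x ord0 k - y ord0 k) *: delta_mx ord0 k.
  apply/rowP => i; rewrite !mxE eqxx/= ltnS leq_eqVlt; case: (eqVneq i k) => [->|ik].
    by rewrite eqxx ltnn mulr1 addrC subrK.
  by rewrite (_ : (i == k :> nat) = false) ?mulr0 ?addr0//; apply/negbTE.
have pa k : `|p k - a| < d.
  apply/rV_norm_ltP => // i; rewrite !mxE; case: ifP => _.
    by have := le_lt_trans (rV_norm_coord (x - a) i) xa; rewrite !mxE.
  by have := le_lt_trans (rV_norm_coord (y - a) i) ya; rewrite !mxE.
have step (k : 'I_n) : `|g (p k.+1) - g (p k) - (x ord0 k - y ord0 k) * partial k g a| <=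
    (e / n.+1%:R) * `|x - y|.
  have xy2 : `|x - y| < 2 * d.
    rewrite (_ : x - y = (x - a) - (y - a)); last by rewrite opprB addrA subrK.
    by apply: le_lt_trans (ler_normB _ _) _; rewrite mulr_natl mulr2n ltrD.
  have xyk : `|x ord0 k - y ord0 k| <= `|x - y|.
    by have := rV_norm_coord (x - y) k; rewrite !mxE.
  have inr t : `|t| <= `|x ord0 k - y ord0 k| -> ball a r (p k + t *: delta_mx ord0 k).
    move=> tk; rewrite -ball_normE /ball_ /= distrC.
    rewrite addrAC; apply: le_lt_trans (ler_normD _ _) _.
    have : `|t *: delta_mx ord0 k : 'rV[R]_n| <= `|t|.
      apply/rV_norm_leP => // i; rewrite !mxE eqxx /= normrM.
      by case: (i == k); rewrite ?normr1 ?normr0 ?mulr1 ?mulr0.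
    have := pa k; lra.
  rewrite pS; have [t tk ->] := @line_MVT _ g (p k) (delta_mx ord0 k) (x ord0 k - y ord0 k)
    (fun t tk => (ar _ (inr t tk) k).1).
  rewrite -mulrBr normrM mulrC ler_pM//.
  exact: (ar _ (inr t tk) k).2.
rewrite -[in g x]pn -[in g y]p0.
rewrite -(@telescope_sumr _ 0 n (fun k => g (p k)))// big_mkord -sumrB.
apply: le_trans (ler_norm_sum _ _ _) _.
apply: (@le_trans _ _ (\sum_(i < n) (e / n.+1%:R * `|x - y|))).
  by apply: ler_sum => k _; rewrite !mxE; exact: step.
rewrite sumr_const card_ord -[_ *+ n]mulr_natl mulrA ler_wpM2r//.
by rewrite mulrCA ger_pMr// ler_pdivrMr// mul1r ler_nat.
Unshelve. all: by end_near. Qed.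

(** Strict differentiability: the linear approximation at [a] controls the
    increment between any two points near [a], with an error relative to their
    distance. This is what is needed to compare the image of a small box near
    [a] with a parallelepiped when [a] need not be a corner of the box, and it
    is what continuous partial derivatives give. *)
Definition strict_diff n m (T : 'rV[R]_n -> 'rV[R]_m) a (L : 'M[R]_(n, m)) :=
  forall e, 0 < e -> \forall d \near (0:R)^'+, forall x y, `|x - a| < d -> `|y - a| < d ->
    `|T x - T y - (x - y) *m L| <= e * `|x - y|.

Lemma partial_strict_diff n m (T : 'rV[R]_n -> 'rV[R]_m) (a : 'rV[R]_n) :
  (\forall x \near a, forall i j, derivable (fun x => T x ord0 j) x (delta_mx ord0 i)) ->
  (forall i j, {for a, continuous (partial i (fun x => T x ord0 j))}) ->
  strict_diff T a (\matrix_(i, j) partial i (fun x => T x ord0 j) a).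
Proof.
move=> dT cT e e0.
have : \forall d \near (0:R)^'+, forall j x y, `|x - a| < d -> `|y - a| < d ->
    `|T x ord0 j - T y ord0 j - \sum_i (x - y) ord0 i *
       partial i (fun x => T x ord0 j) a| <= e * `|x - y|.
  apply: filter_forall => j; apply: partial_strict => //.
  by apply: filterS dT => x dT i; exact: dT.
apply: filterS => d H x y xa ya; apply/rV_norm_leP; first by rewrite mulr_ge0// ltW.
move=> j; rewrite !mxE; under eq_bigr do rewrite [X in _ * X]mxE.
exact: H.
Qed.

Lemma mulmx_bound n m (A : 'M[R]_(n, m)) :
  exists2 C, 0 < C & forall v : 'rV[R]_n, `|v *m A| <= C * `|v|.
Proof.
exists (\sum_i \sum_j `|A i j| + 1).
  by rewrite ltr_wpDl// sumr_ge0// => i _; rewrite sumr_ge0.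
move=> v; apply/rV_norm_leP.
  by rewrite mulr_ge0// addr_ge0// sumr_ge0// => i _; rewrite sumr_ge0.
move=> j; rewrite mxE; apply: le_trans (ler_norm_sum _ _ _) _.
rewrite mulrDl mul1r ler_wpDr// mulr_suml; apply: ler_sum => i _.
rewrite normrM mulrC ler_pM ?rV_norm_coord//.
by rewrite (bigD1 j)//= lerDl sumr_ge0.
Qed.

Lemma strict_diff_lipschitz n m (T : 'rV[R]_n -> 'rV[R]_m) a L : strict_diff T a L ->
  exists2 C, 0 < C & \forall d \near (0:R)^'+, forall x y, `|x - a| < d -> `|y - a| < d ->
    `|T x - T y| <= C * `|x - y|.
Proof.
move=> sT; have [C C0 CL] := mulmx_bound L.
exists (C + 1); first by rewrite addr_gt0.
apply: filterS (sT 1 ltr01) => d H x y xa ya.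
rewrite (_ : T x - T y = (x - y) *m L + (T x - T y - (x - y) *m L)); last first.
  by rewrite [RHS]addrC subrK.
by apply: le_trans (ler_normD _ _) _; rewrite mulrDl lerD// H.
Qed.

Lemma strict_diff_continuous n m (T : 'rV[R]_n -> 'rV[R]_m) a L : strict_diff T a L ->
  {for a, continuous T}.
Proof.
move=> /strict_diff_lipschitz[C C0 CT]; rewrite /prop_for /continuous_at.
apply/(@cvgrPdist_lt _ _ _ (nbhs a)) => e e0.
have [d d0 dT] := near_right_ex CT.
have de0 : 0 < Num.min d (e / C) by rewrite lt_min d0 divr_gt0.
have := near_norm a de0; apply: filterS => x; rewrite lt_min => /andP[xd xe].
rewrite distrC; apply: le_lt_trans (dT _ _ xd _) _; first by rewrite subrr normr0.
by rewrite mulrC -ltr_pdivlMr.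
Qed.

(** The chain rule for [S \o T = id], tested on each basis vector. *)
Lemma strict_diff_inverse n (T S : 'rV[R]_n -> 'rV[R]_n) a A B :
  strict_diff T a A -> strict_diff S (T a) B -> (forall x, S (T x) = x) ->
  A *m B = 1%:M.
Proof.
move=> sT sS ST; have [CB CB0 hB] := mulmx_bound B.
have [CT CT0 hCT] := strict_diff_lipschitz sT.
apply/eqP; rewrite -subr_eq0; apply/eqP/row_matrixP => i; rewrite row0.
apply/eqP; rewrite -normr_eq0; apply/eqP/le_anti; rewrite normr_ge0 andbT.
apply/ler_addgt0Pr => e e0; rewrite add0r.
(* The two error terms below are at most [e2 * CT * t] and [CB * e1 * t]. *)
pose e1 := e / (2 * CB); pose e2 := e / (2 * CT).
have e10 : 0 < e1 by rewrite divr_gt0// mulr_gt0.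
have e20 : 0 < e2 by rewrite divr_gt0// mulr_gt0.
pose v : 'rV[R]_n := delta_mx ord0 i.
have v1 : `|v| <= 1.
  by apply/rV_norm_leP => // j; rewrite !mxE eqxx; case: (j == i); rewrite ?normr1 ?normr0.
have [d1 d10 H1] := near_right_ex (sS _ e20).
near (0:R)^'+ => d.
have d0 : 0 < d by near: d; exact: nbhs_right_gt.
have HT : forall x y, `|x - a| < d -> `|y - a| < d -> `|T x - T y| <= CT * `|x - y|.
  by near: d.
have HT1 : forall x y, `|x - a| < d -> `|y - a| < d ->
    `|T x - T y - (x - y) *m A| <= e1 * `|x - y|.
  by near: d; exact: sT.
have dd1 : CT * d < d1.
  by rewrite mulrC -ltr_pdivlMr//; near: d; apply: nbhs_right_lt; rewrite divr_gt0.
pose t := d / 2.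
have t0 : 0 < t by rewrite divr_gt0.
pose x := a + t *: v.
have xa : `|x - a| <= t.
  by rewrite addrAC subrr add0r normrZ gtr0_norm// ler_piMr// ltW.
have xd : `|x - a| < d by apply: le_lt_trans xa _; rewrite /t; lra.
have aa : `|a - a| < d by rewrite subrr normr0.
have TxTa : `|T x - T a| <= CT * t.
  by apply: le_trans (HT _ _ xd aa) _; rewrite ler_pM2l.
have key : `|t *: (v - v *m (A *m B))| <= t * e.
  rewrite (_ : _ *: _ = (S (T x) - S (T a) - (T x - T a) *m B) +
     (T x - T a - (x - a) *m A) *m B); last first.
    rewrite !ST (_ : x - a = t *: v); last by rewrite addrAC subrr add0r.
    rewrite [(_ - _ *m A) *m B]mulmxBl addrA subrK scalerBr mulmxA.
    by rewrite -!scalemxAl.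
  apply: le_trans (ler_normD _ _) _.
  have -> : t * e = e2 * (CT * t) + CB * (e1 * t).
    by rewrite /e1 /e2; field; rewrite !gt_eqF.
  apply: lerD.
    apply: le_trans (H1 _ _ _ _) _; rewrite ?subrr ?normr0//.
      apply: le_lt_trans TxTa _; apply: le_lt_trans dd1.
      by rewrite ler_pM2l// /t; lra.
    by rewrite ler_pM2l.
  apply: le_trans (hB _) _; rewrite ler_pM2l//.
  by apply: le_trans (HT1 _ _ xd aa) _; rewrite ler_pM2l.
move: key; rewrite normrZ gtr0_norm// ler_pM2l// => key.
by rewrite -normrN -linearN/= opprB rowE mulmxBr mulmx1.
Unshelve. all: by end_near. Qed.

End strict_differentiability.

(** * Bisection of boxes *)

Section bisection.
Context (R : realType) (n : nat).
Implicit Types a w x : 'rV[R]_n.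

Variable P : set 'rV[R]_n -> Prop.
Hypothesis PU : forall A B, measurable A -> measurable B -> A `&` B = set0 ->
  P A -> P B -> P (A `|` B).

(** The sides are halved one coordinate after another: if [P] held for both
    halves it would hold for the box, so it fails for one of them. *)
Lemma halve_coordinates a w t : 0 < t -> (forall i, 0 < w ord0 i) ->
  ~ P (obox a (a + t *: w)) ->
  exists a', [/\ ~ P (obox a' (a' + (t / 2) *: w)),
    forall i, a ord0 i <= a' ord0 i &
    forall i, a' ord0 i + t / 2 * w ord0 i <= a ord0 i + t * w ord0 i].
Proof.
move=> t0 w0 nP.
have addE (u v : 'rV[R]_n) i : (u + v) ord0 i = u ord0 i + v ord0 i by rewrite mxE.
pose om k : 'rV[R]_n := \row_i ((if (i < k)%N then t / 2 else t) * w ord0 i).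
suff /(_ n (leqnn n))[a' [nPa' H1 H2]] : forall k, (k <= n)%N ->
    exists a', [/\ ~ P (obox a' (a' + om k)), forall i, a ord0 i <= a' ord0 i &
    forall i, a' ord0 i + om k ord0 i <= a ord0 i + t * w ord0 i].
  have omn : om n = (t / 2) *: w by apply/rowP => i; rewrite !mxE ltn_ord.
  rewrite omn in nPa' H2; exists a'; split => // i.
  by have := H2 i; rewrite !mxE.
elim=> [_|k IH kn].
  exists a; have om0 : om 0%N = t *: w by apply/rowP => i; rewrite !mxE.
  by rewrite om0; split => // i; rewrite !mxE.
have [a' [nPa' H1 H2]] := IH (ltnW kn).
pose ik := Ordinal kn.
pose e : 'rV[R]_n := (t / 2 * w ord0 ik) *: delta_mx ord0 ik.
have ei i : e ord0 i = if i == ik then t / 2 * w ord0 ik else 0.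
  by rewrite !mxE eqxx /=; case: eqP => _; rewrite ?mulr1 ?mulr0.
have omS i : om k.+1 ord0 i = if i == ik then t / 2 * w ord0 ik else om k ord0 i.
  rewrite !mxE; case: eqVneq => [->|iik]; first by rewrite /= ltnSn.
  by rewrite ltnS leq_eqVlt (_ : (i == k :> nat) = false)//; exact/negbTE.
have omk : om k ord0 ik = t * w ord0 ik by rewrite mxE /= ltnn.
have tw0 : 0 < t / 2 * w ord0 ik by rewrite mulr_gt0// divr_gt0.
have tw2 : t * w ord0 ik = t / 2 * w ord0 ik + t / 2 * w ord0 ik by lra.
have split_box : obox a' (a' + om k) =
    obox a' (a' + om k.+1) `|` obox (a' + e) (a' + e + om k.+1).
  apply/seteqP; split => v /=.
    move=> Hv; have [vle|vgt] := leP (v ord0 ik) (a' ord0 ik + t / 2 * w ord0 ik).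
      left => i; have := Hv i; rewrite !addE omS.
      by case: eqVneq => [->|//] /andP[-> _]; rewrite vle.
    right => i; have := Hv i; rewrite !addE omS ei.
    case: eqVneq => [->|_]; last by rewrite addr0.
    by rewrite omk vgt tw2 addrA => /andP[_ ->].
  move=> [] Hv i; have := Hv i; rewrite !addE omS ?ei.
    case: eqVneq => [->|//]; rewrite omk => /andP[-> vle] /=.
    by apply: le_trans vle _; rewrite tw2 addrA lerDl ltW.
  case: eqVneq => [->|_]; last by rewrite addr0.
  rewrite omk tw2 addrA => /andP[vgt ->]; rewrite andbT.
  by apply: lt_trans vgt; rewrite ltrDl.
have disj : obox a' (a' + om k.+1) `&` obox (a' + e) (a' + e + om k.+1) = set0.
  apply/seteqP; split => // v [/(_ ik) + /(_ ik)].
  rewrite !addE omS ei eqxx => /andP[_ v1] /andP[v2 _].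
  by have := lt_le_trans v2 v1; rewrite ltxx.
have [P1|nP1] := pselect (P (obox a' (a' + om k.+1))); last first.
  exists a'; split => // i; apply: le_trans (H2 i); rewrite lerD2l omS.
  by case: eqVneq => [->|//]; rewrite omk tw2 lerDl ltW.
have [P2|nP2] := pselect (P (obox (a' + e) (a' + e + om k.+1))).
  by case: nPa'; rewrite split_box; apply: PU => //; exact: measurable_obox.
exists (a' + e); split => // i; rewrite addE ei.
  apply: le_trans (H1 i) _; rewrite lerDl; case: ifP => // _; exact: ltW.
apply: le_trans (H2 i); rewrite omS.
by case: eqVneq => [->|//]; rewrite ?addr0// omk tw2 addrA.
Qed.

(** A property stable under disjoint unions that holds for all small boxes near
    each point, homothetic to a given one, holds for that one: otherwise it
    would fail for a nested sequence of boxes shrinking to a point. Keeping the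
    boxes homothetic bounds the ratio of their sides. *)
Lemma box_bisection a w : (forall i, 0 < w ord0 i) ->
  (forall x, \forall t \near (0:R)^'+, forall a',
     (forall i, a' ord0 i <= x ord0 i <= a' ord0 i + t * w ord0 i) ->
     P (obox a' (a' + t *: w))) ->
  P (obox a (a + w)).
Proof.
move=> w0 loc; apply: contrapT => nP.
pose r k : R := 2^-1 ^+ k.
have r0 k : 0 < r k by rewrite exprn_gt0// invr_gt0.
have rS k : r k.+1 = r k / 2 by rewrite /r exprSr.
have step k (b : 'rV[R]_n) : {b' | ~ P (obox b (b + r k *: w)) ->
   [/\ ~ P (obox b' (b' + r k.+1 *: w)), forall i, b ord0 i <= b' ord0 i &
    forall i, b' ord0 i + r k.+1 * w ord0 i <= b ord0 i + r k * w ord0 i]}.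
  apply: cid; have [Pb|nPb] := pselect (P (obox b (b + r k *: w))); first by exists b.
  have [b' Hb'] := halve_coordinates (r0 k) w0 nPb.
  by exists b' => _; rewrite rS.
pose s := fix s k := if k is k'.+1 then sval (step k' (s k')) else a.
have nPs k : ~ P (obox (s k) (s k + r k *: w)).
  elim: k => [|k IH]; first by rewrite /r expr0 scale1r.
  by have [] := svalP (step k (s k)) IH.
have sS k i : s k ord0 i <= s k.+1 ord0 i.
  by have [_ + _] := svalP (step k (s k)) (nPs k); apply.
have sS' k i : s k.+1 ord0 i + r k.+1 * w ord0 i <= s k ord0 i + r k * w ord0 i.
  by have [_ _] := svalP (step k (s k)) (nPs k); apply.
have ub i j k : s j ord0 i <= s k ord0 i + r k * w ord0 i.
  have up m l : s m ord0 i <= s (m + l)%N ord0 i.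
    by elim: l => [|l IH]; rewrite ?addn0// addnS; apply: le_trans IH (sS _ _).
  have dn m l : s (m + l)%N ord0 i + r (m + l)%N * w ord0 i <= s m ord0 i + r m * w ord0 i.
    by elim: l => [|l IH]; rewrite ?addn0// addnS; apply: le_trans (sS' _ _) IH.
  apply: le_trans (up j k) _; rewrite addnC; apply: le_trans (dn k j).
  by rewrite lerDl mulr_ge0// ltW.
pose x : 'rV[R]_n := \row_i sup (range (fun k => s k ord0 i)).
have hs i : has_sup (range (fun k => s k ord0 i)).
  split; first by exists (s 0%N ord0 i), 0%N.
  by exists (s 0%N ord0 i + r 0%N * w ord0 i) => _ [k _ <-].
have sx k i : s k ord0 i <= x ord0 i <= s k ord0 i + r k * w ord0 i.
  rewrite mxE; apply/andP; split.
    by apply: ub_le_sup; [exact: (hs i).2|exists k].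
  by apply: ge_sup; [exact: (hs i).1|move=> _ [j _ <-]].
have [d /= d0 dP] := loc x.
have /cvgrPdist_lt/(_ d d0)[k _ /(_ k (leqnn k))/= rk] : r k @[k --> \oo] --> (0:R).
  by apply: cvg_expr; rewrite ger0_norm ?invr_ge0// invf_lt1// ltr1n.
by apply: (nPs k); apply: dP => //; exact: sx.
Qed.

End bisection.

(** * Measures with a density *)

Section density.
Local Open Scope ereal_scope.
Context d (X : measurableType d) (R : realType) (mu : {measure set X -> \bar R}).

(** The measurability and the sign of [J] are arguments of the definition
    because the measure structure attached to it depends on them. *)
Definition density_measure (J : X -> R) of measurable_fun [set: X] J &
  (forall x, (0 <= J x)%R) := fun E : set X => \int[mu]_(x in E) (J x)%:E.

Context (J : X -> R) (mJ : measurable_fun [set: X] J) (J0 : forall x, (0 <= J x)%R).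
Local Notation dens := (density_measure mJ J0).

Let density0 : dens set0 = 0.
Proof. exact: integral_set0. Qed.

Let density_ge0 E : 0 <= dens E.
Proof. by apply: integral_ge0 => x _; rewrite lee_fin. Qed.

Let density_sigma_additive : semi_sigma_additive dens.
Proof.
apply: semi_sigma_additive_nng_induced; first exact/measurable_EFinP.
by move=> x; rewrite lee_fin.
Qed.

HB.instance Definition _ := isMeasure.Build _ _ _ dens
  density0 density_ge0 density_sigma_additive.

Import HBNNSimple.

(** Both sides are monotone limits along simple functions, for which the
    formula is the definition of [density_measure]. *)
Lemma ge0_integral_density (f : X -> \bar R) : measurable_fun [set: X] f ->
  (forall x, 0 <= f x) ->
  \int[dens]_x f x = \int[mu]_x (f x * (J x)%:E).
Proof.
move=> mf f0; pose h := nnsfun_approx measurableT mf.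
have fE x : f x = lim ((EFin \o h n) x @[n --> \oo]).
  by apply/esym/cvg_lim => //; exact: cvg_nnsfun_approx.
have -> : \int[dens]_x f x =
    lim (\int[dens]_x (EFin \o h n) x @[n --> \oo]).
  under eq_integral do rewrite fE.
  apply: monotone_convergence => //.
  - by move=> n; exact/measurable_EFinP.
  - by move=> n x _ /=; rewrite lee_fin.
  - by move=> x _ a b ab; rewrite lee_fin; exact/lefP/nd_nnsfun_approx.
have -> : \int[mu]_x (f x * (J x)%:E) =
    lim (\int[mu]_x ((EFin \o h n) x * (J x)%:E) @[n --> \oo]).
  have fg x : f x * (J x)%:E = lim (((EFin \o h n) x * (J x)%:E) @[n --> \oo]).
    by apply/esym/cvg_lim => //; apply: cvgeZr => //; exact: cvg_nnsfun_approx.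
  under eq_integral do rewrite fg.
  apply: monotone_convergence => //.
  - by move=> n; apply/emeasurable_funM; exact/measurable_EFinP.
  - by move=> n x _ /=; rewrite mule_ge0 ?lee_fin.
  - move=> x _ a b ab/=; rewrite lee_wpmul2r ?lee_fin//.
    exact/lefP/nd_nnsfun_approx.
suff suf m : \int[dens]_x (EFin \o h m) x = \int[mu]_x ((EFin \o h m) x * (J x)%:E).
  by under eq_fun do rewrite suf.
transitivity (\int[dens]_x
    (\sum_(y \in range (h m)) (y * \1_(h m @^-1` [set y]) x)%:E)).
  by apply: eq_integral => x _; rewrite /= fimfunE -fsumEFin.
rewrite ge0_integral_fsum//; last 2 first.
- by move=> r; apply/measurable_EFinP; exact: measurable_funM.
- by move=> r x _; exact: nnfun_muleindic_ge0.
transitivity (\int[mu]_x (\sum_(y \in range (h m))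
    (y * \1_(h m @^-1` [set y]) x)%:E * (J x)%:E)); last first.
  apply: eq_integral => x _; rewrite -ge0_mule_fsuml => [|y].
    by rewrite fsumEFin// -fimfunE.
  exact: nnfun_muleindic_ge0.
rewrite ge0_integral_fsum//; last 2 first.
- by move=> r; apply: emeasurable_funM; apply/measurable_EFinP => //; exact: measurable_funM.
- by move=> r x _; apply: mule_ge0; [exact: nnfun_muleindic_ge0|rewrite lee_fin].
apply: eq_fsbigr => r /set_mem[t _ tr].
have r0 : (0 <= r)%R by rewrite -tr.
under eq_integral do rewrite EFinM.
under [RHS]eq_integral do rewrite EFinM -muleA.
rewrite !ge0_integralZl//.
- rewrite integral_indic// setIT; congr (_ * _).
  transitivity (\int[mu]_(x in h m @^-1` [set r]) (J x)%:E); first by [].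
  rewrite integral_mkcond; apply: eq_integral => x _.
  by rewrite muleC epatch_indic.
- by apply: emeasurable_funM; exact/measurable_EFinP.
- by move=> x _; rewrite mule_ge0 ?lee_fin.
- exact/measurable_EFinP.
Qed.

End density.

(** * The change of variables formula *)

Section change_of_variables.
Context (R : realType) (n : nat).
Local Notation lam := (lebesgue_rV R n).
Implicit Types x y a w : 'rV[R]_n.
Variables (U : set 'rV[R]_n) (T S : 'rV[R]_n -> 'rV[R]_n) (A B : 'rV[R]_n -> 'M[R]_n).
Hypothesis oU : open U.
Hypothesis TU : forall x, U (T x).
Hypothesis TK : cancel T S.
Hypothesis SK : forall y, U y -> T (S y) = y.
Hypothesis dT : forall x, strict_diff T x (A x).
Hypothesis dS : forall y, U y -> strict_diff S y (B y).
Hypothesis cA : continuous (fun x => \det (A x)).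

Let J x : R := `|\det (A x)|.

Let AB x : A x *m B (T x) = 1%:M.
Proof. by apply: strict_diff_inverse (dT x) (dS (TU x)) _ => z; exact: TK. Qed.

Let uA x : A x \in unitmx.
Proof. by have [] := mulmx1_unit (AB x). Qed.

Let AK x : invmx (A x) = B (T x).
Proof. by rewrite -[LHS]mulmx1 -(AB x) mulmxA mulVmx ?mul1mx. Qed.

Let J_gt0 x : 0 < J x.
Proof. by rewrite normr_gt0 -unitfE -unitmxE. Qed.

Let image E := U `&` S @^-1` E.

Let S_U := S \_ U.

(** [S] is only regular on [U], so it is extended by a constant outside [U]. *)
Lemma measurable_inverse_patch : measurable_fun [set: 'rV[R]_n] S_U.
Proof.
have mU := open_measurable_rV oU.
apply: measurable_fun_rVP => i.
have -> : (fun t => S_U t ord0 i) = (fun y => S y ord0 i) \_ U.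
  by apply/funext => y; rewrite /S_U /patch; case: ifP => // _; rewrite mxE.
apply/(measurable_restrictT _ mU).
apply: open_continuous_measurable_rV => // y Uy.
apply: (@continuous_comp _ _ _ S (fun v : 'rV[R]_n => v ord0 i)).
  exact: strict_diff_continuous (dS Uy).
exact: coord_continuous.
Qed.

Lemma image_patch E : image E = S_U @^-1` E `&` U.
Proof.
apply/seteqP; split => y [] /=; rewrite /S_U /patch.
  by move=> Uy SE; rewrite mem_set.
by move=> + Uy; rewrite mem_set.
Qed.

Lemma measurable_image E : measurable E -> measurable (image E).
Proof.
move=> mE; rewrite image_patch; apply: measurableI; last exact: open_measurable_rV.
by rewrite -[X in measurable X]setTI; exact: measurable_inverse_patch.
Qed.

Let lower_width w : (forall i, 0 < w ord0 i) ->
  exists2 m : R, 0 < m & forall i, m <= w ord0 i.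
Proof.
move=> w0; near (0:R)^'+ => m; exists m; first by near: m; exact: nbhs_right_gt.
by near: m; apply: filter_forall => i; exact: nbhs_right_le.
Unshelve. all: by end_near. Qed.

Let in_box_dist (t W : R) a w x : 0 <= t -> 0 <= W -> (forall i, w ord0 i <= W) ->
  (forall i, a ord0 i <= x ord0 i <= a ord0 i + t * w ord0 i) ->
  forall y, (forall i, a ord0 i <= y ord0 i <= a ord0 i + t * w ord0 i) ->
  `|y - x| <= t * W.
Proof.
move=> t0 W0 wW ax y ay; apply/rV_norm_leP => [|i]; first exact: mulr_ge0.
rewrite !mxE; have := ax i; have := ay i; have := ler_wpM2l t0 (wW i).
by move=> ? /andP[? ?] /andP[? ?]; rewrite ler_norml; apply/andP; split; lra.
Qed.

(** [T] maps the box into the image of a box enlarged in proportion [e] under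
    the affine map with value [T a] at the corner [a] and linear part [A x]. *)
Lemma image_box_le x w (e : R) : (forall i, 0 < w ord0 i) -> 0 < e ->
  \forall t \near (0:R)^'+, forall a, (forall i, a ord0 i <= x ord0 i <= a ord0 i + t * w ord0 i) ->
    (lam (image (obox a (a + t *: w))) <=
     ((1 + e + e) ^+ n * (J x * \prod_(i < n) (t * w ord0 i)))%:E)%E.
Proof.
move=> w0 e0.
have [C C0 hC] := mulmx_bound (invmx (A x)).
have [m m0 mw] := lower_width w0.
pose W := `|w| + 1.
have W0 : 0 < W by rewrite ltr_wpDl.
have wW i : w ord0 i <= W.
  by rewrite ler_wpDr//; apply: le_trans (ler_norm _) (rV_norm_coord _ _).
(* [r] below is bounded by [C * eta * t * W], to be compared with [e * t * m],
   a lower bound of [e] times each side. *)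
pose eta := e * m / (C * W).
have eta0 : 0 < eta by rewrite divr_gt0 ?mulr_gt0.
have [d d0 Hd] := near_right_ex (dT x eta0).
near=> t => a ax.
have t0 : 0 < t by near: t; exact: nbhs_right_gt.
have tWd : t * W < d.
  by rewrite -ltr_pdivlMr//; near: t; apply: nbhs_right_lt; rewrite divr_gt0.
have aa i : a ord0 i <= a ord0 i <= a ord0 i + t * w ord0 i.
  by rewrite lexx lerDl mulr_ge0// ltW.
have t0' := ltW t0; have W0' := ltW W0.
pose Q := obox (- ((e * t) *: w)) (((1 + e) * t) *: w).
have sub : image (obox a (a + t *: w)) `<=` (fun y => (y - T a) *m invmx (A x)) @^-1` Q.
  move=> y [Uy /= Sy]; rewrite -(SK Uy); set z := S y in Sy *.
  have zb i : a ord0 i <= z ord0 i <= a ord0 i + t * w ord0 i.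
    by have := Sy i; rewrite !mxE => /andP[/ltW -> ->].
  have za := in_box_dist t0' W0' wW aa zb.
  have zx := in_box_dist t0' W0' wW ax zb.
  have ax' := in_box_dist t0' W0' wW ax aa.
  pose r := (T z - T a - (z - a) *m A x) *m invmx (A x).
  have -> : (T z - T a) *m invmx (A x) = (z - a) + r.
    by rewrite /r [in RHS]mulmxBl mulmxK// [RHS]addrC subrK.
  have rb : `|r| <= e * (m * t).
    apply: le_trans (hC _) _.
    have -> : e * (m * t) = C * (eta * (t * W)) by rewrite /eta; field; rewrite !gt_eqF.
    rewrite ler_pM2l//; apply: le_trans (Hd _ _ _ _) _; rewrite ?ler_pM2l//.
      exact: le_lt_trans zx tWd.
    exact: le_lt_trans ax' tWd.
  clearbody r => i; rewrite !mxE.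
  have := Sy i; rewrite !mxE => /andP[z1 z2].
  have := le_trans (rV_norm_coord r i) rb; rewrite ler_norml.
  have : e * (m * t) <= e * t * w ord0 i.
    by rewrite mulrCA [_ * w _ _]mulrC ler_pM2r ?mulr_gt0.
  by move=> ? /andP[? ?]; apply/andP; split; lra.
apply: le_trans (le_measure _ _ _ sub) _.
- by apply: mem_set; apply: measurable_image; exact: measurable_obox.
- by apply: mem_set; apply: measurable_affine_preimage; exact: measurable_obox.
rewrite [X in (X <= _)%E](lebesgue_rV_affine (T a) (uA x) (measurable_obox _ _)).
rewrite lebesgue_rV_obox => [|i]; last first.
  rewrite !mxE; apply: (@le_trans _ _ 0).
    by rewrite oppr_le0 !mulr_ge0// ltW.
  by rewrite !mulr_ge0 ?addr_ge0// ltW.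
rewrite -EFinM lee_fin mulrCA ler_pM2l; last exact: J_gt0.
rewrite -[X in _ ^+ X]card_ord -prodr_const -big_split/=.
rewrite le_eqVlt; apply/predU1P; left.
by apply: eq_bigr => i _; rewrite !mxE; ring.
Unshelve. all: by end_near. Qed.

(** Conversely, [S] maps the image of a shrunk box under the same affine map
    into the box, by the strict differentiability of [S] at [T x]. *)
Lemma image_box_ge x w (e : R) : (forall i, 0 < w ord0 i) -> 0 < e -> e + e < 1 ->
  \forall t \near (0:R)^'+, forall a, (forall i, a ord0 i <= x ord0 i <= a ord0 i + t * w ord0 i) ->
    (((1 - e - e) ^+ n * (J x * \prod_(i < n) (t * w ord0 i)))%:E <=
     lam (image (obox a (a + t *: w))))%E.
Proof.
move=> w0 e0 e1.
have [C C0 hC] := mulmx_bound (A x).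
have [CT CT0 hCT] := strict_diff_lipschitz (dT x).
have [m m0 mw] := lower_width w0.
pose W := `|w| + 1.
have W0 : 0 < W by rewrite ltr_wpDl.
have wW i : w ord0 i <= W.
  by rewrite ler_wpDr//; apply: le_trans (ler_norm _) (rV_norm_coord _ _).
(* The factor 1/2 makes the first inequality of the conclusion strict, as the
   half-open box requires. *)
pose eta := e / 2 * m / (C * W).
have eta0 : 0 < eta by rewrite divr_gt0 ?mulr_gt0// divr_gt0.
have [d /= d0 [Hd HU]] : exists2 d : R, 0 < d & (forall y z, `|y - T x| < d -> `|z - T x| < d ->
    `|S y - S z - (y - z) *m B (T x)| <= eta * `|y - z|) /\
    (forall y, `|y - T x| < d -> U y).
  have /nbhs_ballP[r /= r0 rU] : nbhs (T x) U by apply: open_nbhs_nbhs; split.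
  near (0:R)^'+ => d; exists d; first by near: d; exact: nbhs_right_gt.
  split; first by near: d; apply: dS.
  move=> y yd; apply: rU; rewrite -ball_normE /ball_ /= distrC.
  by apply: lt_le_trans yd _; near: d; exact: nbhs_right_le.
have [d1 d10 Hd1] := near_right_ex hCT.
near=> t => a ax.
have t0 : 0 < t by near: t; exact: nbhs_right_gt.
have tWd : (C + CT) * (t * W) < d.
  rewrite mulrCA -ltr_pdivlMr; last by apply: mulr_gt0; first exact: addr_gt0.
  near: t; apply: nbhs_right_lt; apply: divr_gt0 => //.
  by apply: mulr_gt0; first exact: addr_gt0.
have tWd1 : t * W < d1.
  by rewrite -ltr_pdivlMr//; near: t; apply: nbhs_right_lt; rewrite divr_gt0.
have aa i : a ord0 i <= a ord0 i <= a ord0 i + t * w ord0 i.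
  by rewrite lexx lerDl mulr_ge0// ltW.
have t0' := ltW t0; have W0' := ltW W0.
have ax' := in_box_dist t0' W0' wW ax aa.
have TaTx : `|T a - T x| <= CT * (t * W).
  apply: le_trans (Hd1 _ _ _ _) _; rewrite ?subrr ?normr0 ?ler_pM2l//.
  exact: le_lt_trans ax' tWd1.
have Tad : `|T a - T x| < d.
  by apply: le_lt_trans TaTx _; apply: le_lt_trans tWd; rewrite ler_pM2r ?mulr_gt0// lerDr ltW.
have etw i : e / 2 * (m * t) <= e / 2 * (t * w ord0 i).
  by rewrite ler_pM2l ?divr_gt0// mulrC ler_pM2l.
have tw0 i : 0 < t * w ord0 i by rewrite mulr_gt0.
pose Q := obox ((e * t) *: w) (((1 - e) * t) *: w).
have sub : (fun y => (y - T a) *m invmx (A x)) @^-1` Q `<=` image (obox a (a + t *: w)).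
  move=> y /=; set u := _ *m invmx _ => Qu.
  have uE : u *m A x = y - T a by rewrite mulmxKV.
  have uB : (y - T a) *m B (T x) = u by rewrite -AK.
  move: u Qu uE uB => u Qu uE uB.
  have uW : `|u| <= t * W.
    apply/rV_norm_leP => [|i]; first exact: mulr_ge0.
    have := Qu i; rewrite !mxE => /andP[u1 u2]; have := tw0 i.
    have := ler_wpM2l t0' (wW i); have : 0 < e * (t * w ord0 i) by rewrite mulr_gt0.
    by move=> ? ? ?; rewrite ler_norml; apply/andP; split; lra.
  have ya : `|y - T a| <= C * (t * W).
    by rewrite -uE; apply: le_trans (hC _) _; rewrite ler_pM2l.
  have yd : `|y - T x| < d.
    apply: le_lt_trans tWd; rewrite (_ : y - T x = (y - T a) + (T a - T x)); last first.
      by rewrite addrA subrK.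
    by apply: le_trans (ler_normD _ _) _; rewrite mulrDl lerD.
  split; first exact: HU.
  have r1 := Hd _ _ yd Tad; rewrite TK uB in r1.
  set r := S y - a - u in r1.
  have rb : `|r| <= e / 2 * (m * t).
    apply: le_trans r1 _; apply: (@le_trans _ _ (eta * (C * (t * W)))).
      by rewrite ler_pM2l.
    rewrite le_eqVlt; apply/predU1P; left.
    by rewrite /eta; field; rewrite !gt_eqF.
  move=> i; rewrite !mxE.
  have -> : S y ord0 i = a ord0 i + u ord0 i + r ord0 i by rewrite !mxE; ring.
  clearbody r; have := Qu i; rewrite !mxE => /andP[u1 u2].
  have := le_trans (rV_norm_coord r i) (le_trans rb (etw i)); rewrite ler_norml.
  have : 0 < e * (t * w ord0 i) by rewrite mulr_gt0.
  by move=> ? /andP[? ?]; apply/andP; split; lra.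
apply: le_trans (le_measure _ _ _ sub); last 2 first.
- by apply: mem_set; apply: measurable_affine_preimage; exact: measurable_obox.
- by apply: mem_set; apply: measurable_image; exact: measurable_obox.
rewrite [X in (_ <= X)%E](lebesgue_rV_affine (T a) (uA x) (measurable_obox _ _)).
rewrite lebesgue_rV_obox => [|i]; last first.
  by rewrite !mxE -!mulrA ler_pM2r//; lra.
rewrite -EFinM lee_fin mulrCA ler_pM2l; last exact: J_gt0.
rewrite -[X in _ ^+ X]card_ord -prodr_const -big_split/=.
rewrite le_eqVlt; apply/predU1P; left.
by apply: eq_bigr => i _; rewrite !mxE; ring.
Unshelve. all: by end_near. Qed.


Let mJ : measurable_fun [set: 'rV[R]_n] J.
Proof.
apply: open_continuous_measurable_rV => [|x _]; first exact: openT.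
by apply: continuous_comp; [exact: cA|exact: norm_continuous].
Qed.

Let J_ge0 x : 0 <= J x.
Proof. exact: normr_ge0. Qed.

Let mu : {measure set 'rV[R]_n -> \bar R} := density_measure lam mJ J_ge0.

(* The measure of the image under [T]. *)
Let nu : {measure set 'rV[R]_n -> \bar R} :=
  measure_function_pushforward__canonical__measure_function_Measure
    (measure_function_mrestr__canonical__measure_function_Measure
       lam (open_measurable_rV oU)) measurable_inverse_patch.

Let nuE E : nu E = lam (image E).
Proof. by rewrite image_patch. Qed.

Let density_box x w (e : R) : (forall i, 0 < w ord0 i) -> 0 < e -> e < 1 ->
  \forall t \near (0:R)^'+, forall a, (forall i, a ord0 i <= x ord0 i <= a ord0 i + t * w ord0 i) ->
    (((1 - e) * (J x * \prod_(i < n) (t * w ord0 i)))%:E <= mu (obox a (a + t *: w)) <=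
    ((1 + e) * (J x * \prod_(i < n) (t * w ord0 i)))%:E)%E.
Proof.
move=> w0 e0 e1.
pose W := `|w| + 1.
have W0 : 0 < W by rewrite ltr_wpDl.
have wW i : w ord0 i <= W.
  by rewrite ler_wpDr//; apply: le_trans (ler_norm _) (rV_norm_coord _ _).
have eJ : 0 < e * J x by rewrite mulr_gt0.
have cJ : {for x, continuous J}.
  by apply: continuous_comp; [exact: cA|exact: norm_continuous].
have /cvgrPdist_le/(_ _ eJ) := cJ.
rewrite -nbhs_nearE => /nbhs_ballP[d /= d0 dJ].
near=> t => a ax.
have t0 : 0 < t by near: t; exact: nbhs_right_gt.
have tWd : t * W < d.
  by rewrite -ltr_pdivlMr//; near: t; apply: nbhs_right_lt; rewrite divr_gt0.
have Jb y : obox a (a + t *: w) y -> `|J x - J y| <= e * J x.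
  move=> Qy; apply: dJ; rewrite -ball_normE /ball_ /= distrC.
  apply: le_lt_trans tWd; apply: (in_box_dist (ltW t0) (ltW W0) wW ax) => i.
  by have := Qy i; rewrite !mxE => /andP[/ltW -> ->].
have lamQ : lam (obox a (a + t *: w)) = (\prod_(i < n) (t * w ord0 i))%:E.
  rewrite lebesgue_rV_obox => [|i]; last by rewrite !mxE lerDl mulr_ge0// ltW.
  by congr (_%:E); apply: eq_bigr => i _; rewrite !mxE addrAC subrr add0r.
have cstQ c : (\int[lam]_(y in obox a (a + t *: w)) (cst c%:E) y =
    (c * \prod_(i < n) (t * w ord0 i))%:E)%E.
  rewrite integral_cst; last exact: measurable_obox.
  by rewrite EFinM -lamQ.
rewrite !mulrA -!cstQ; apply/andP; split; apply: ge0_le_integral => //=.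
- exact: measurable_obox.
- by move=> y _; rewrite lee_fin mulr_ge0// subr_ge0 ltW.
- by apply: (measurable_funS measurableT) => //; exact/measurable_EFinP.
- move=> y /Jb; rewrite ler_norml lee_fin => /andP[? ?]; lra.
- exact: measurable_obox.
- by move=> y _; rewrite lee_fin.
- by apply: (measurable_funS measurableT) => //; exact/measurable_EFinP.
- move=> y /Jb; rewrite ler_norml lee_fin => /andP[? ?]; lra.
Unshelve. all: by end_near. Qed.

Let small_delta (e : R) : 0 < e -> exists d : R, [/\ 0 < d, d + d < 1,
  (1 + d + d) ^+ n <= (1 + e) * (1 - d) & 1 + d <= (1 + e) * (1 - d - d) ^+ n].
Proof.
move=> e0.
(* The inequalities are strict at [d = 0] and polynomial in [d]. *)
have near_pos (p : {poly R}) : 0 < p.[0] -> \forall d \near (0:R)^'+, 0 <= p.[d].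
  move=> p0; have H : \forall d \near (0:R), 0 < p.[d].
    exact: (@cvgr_gt _ _ _ _ (horner p) p.[0] (@continuous_horner R p 0)).
  by apply: filterS (cvg_within _ H) => d /ltW.
near (0:R)^'+ => d; exists d; split.
- by near: d; exact: nbhs_right_gt.
- have : d < 2^-1 by near: d; apply: nbhs_right_lt; rewrite invr_gt0.
  lra.
- pose p : {poly R} := (1 + e)%:P * (1 - 'X) - (1 + 'X + 'X) ^+ n.
  have : 0 <= p.[d].
    near: d; apply: near_pos; rewrite /p !hornerE.
    by rewrite !(addr0, subr0, expr1n, mulr1); lra.
  by rewrite /p !hornerE subr_ge0.
- pose p : {poly R} := (1 + e)%:P * (1 - 'X - 'X) ^+ n - (1 + 'X).
  have : 0 <= p.[d].
    near: d; apply: near_pos; rewrite /p !hornerE.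
    by rewrite !(addr0, subr0, expr1n, mulr1); lra.
  by rewrite /p !hornerE subr_ge0.
Unshelve. all: by end_near. Qed.

Let nu_mu_box (e : R) a w : 0 < e -> (forall i, 0 < w ord0 i) ->
  [/\ (nu (obox a (a + w)) <= (1 + e)%:E * mu (obox a (a + w)))%E,
      (mu (obox a (a + w)) <= (1 + e)%:E * nu (obox a (a + w)))%E &
      (mu (obox a (a + w)) < +oo)%E].
Proof.
move=> e0 w0.
apply: (@box_bisection R n (fun E => [/\ nu E <= (1 + e)%:E * mu E,
  mu E <= (1 + e)%:E * nu E & mu E < +oo]%E)) => //.
  move=> E F mE mF EF [E1 E2 E3] [F1 F2 F3].
  rewrite [mu _](measureU mu mE mF EF) [nu _](measureU nu mE mF EF).
  have e1 : 0 <= 1 + e by rewrite addr_ge0 ?ltW.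
  split; last exact: lte_add_pinfty.
    by rewrite ge0_muleDr ?measure_ge0//; exact: leeD.
  by rewrite ge0_muleDr ?measure_ge0//; exact: leeD.
move=> x; have [d [d0 d1 d2 d3]] := small_delta e0.
have d1' : d < 1 by lra.
apply: filterS3 (density_box x w0 d0 d1') (image_box_le x w0 d0) (image_box_ge x w0 d0 d1).
move=> t H1 H2 H3 a' ax.
move: (H1 a' ax) (H2 a' ax) (H3 a' ax) => {H1 H2 H3}; rewrite -nuE.
set Q := obox _ _; set p := J x * _ => /andP[m1 m2] n1 n2.
have p0 : 0 <= p.
  have := le_trans m1 m2; rewrite lee_fin => pp.
  by rewrite -(pmulr_rge0 p (addr_gt0 d0 d0)); lra.
have e1 : 0 <= 1 + e by rewrite addr_ge0 ?ltW.
clearbody p; split; last by apply: le_lt_trans m2 _; rewrite ltry.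
  apply: le_trans n1 _; apply: le_trans (lee_wpmul2l _ m1); last by rewrite lee_fin.
  by rewrite -EFinM lee_fin mulrA ler_wpM2r.
apply: le_trans m2 _; apply: le_trans (lee_wpmul2l _ n2); last by rewrite lee_fin.
by rewrite -EFinM lee_fin mulrA ler_wpM2r.
Qed.

(** On small boxes near any point both sides are equal up to a factor [1 + e];
    by bisection this holds for all boxes, and [e] is arbitrary. *)
Lemma lebesgue_image E : measurable E -> lam (image E) = (\int[lam]_(x in E) (J x)%:E)%E.
Proof.
move=> mE; rewrite -nuE -[RHS]/(mu E); move: E mE; apply: eq_measure_rV => a b ab.
pose w := b - a.
have w0 i : 0 < w ord0 i by rewrite !mxE subr_gt0.
have -> : b = a + w by rewrite addrC subrK.
have [_ _ mfin] := nu_mu_box a ltr01 w0.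
have mfin' : mu (obox a (a + w)) \is a fin_num by rewrite ge0_fin_numE ?measure_ge0.
have [nfin _ _] := nu_mu_box a ltr01 w0.
have {}nfin : (nu (obox a (a + w)) < +oo)%E.
  by apply: le_lt_trans nfin _; rewrite -(fineK mfin') -EFinM ltry.
have nfin' : nu (obox a (a + w)) \is a fin_num by rewrite ge0_fin_numE ?measure_ge0.
split => //; have H e (e0 : 0 < e) := nu_mu_box a e0 w0.
rewrite -(fineK mfin') -(fineK nfin') in H *.
set m := fine (mu _) in H *; set v := fine (nu _) in H *.
have m0 : 0 <= m by rewrite fine_ge0// measure_ge0.
have v0 : 0 <= v by rewrite fine_ge0// measure_ge0.
have key (r s : R) : 0 <= s -> (forall e, 0 < e -> r <= (1 + e) * s) -> r <= s.
  move=> s0 rs; apply/ler_addgt0Pr => e e0.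
  have e1 : 0 < e / (s + 1) by rewrite divr_gt0// ltr_wpDl.
  apply: le_trans (rs _ e1) _; rewrite mulrDl mul1r lerD2l.
  rewrite mulrAC ler_pdivrMr ?ltr_wpDl// ler_pM2l//; lra.
congr (_%:E); apply/le_anti/andP; split; apply: key => // e e0.
  by have [+ _ _] := H e e0; rewrite -EFinM lee_fin.
by have [_ + _] := H e e0; rewrite -EFinM lee_fin.
Qed.

(** The change of variables formula for a diffeomorphism [T] of R^n onto the
    open set [U], for nonnegative functions. *)
Theorem ge0_change_of_variables (F : 'rV[R]_n -> \bar R) :
  measurable_fun U F -> (forall y, U y -> (0 <= F y)%E) ->
  (\int[lam]_(y in U) F y = \int[lam]_x (F (T x) * (`|\det (A x)|)%:E))%E.
Proof.
move=> mF F0; have mU := open_measurable_rV oU.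
have mT : measurable_fun [set: 'rV[R]_n] T.
  apply: measurable_fun_rVP => i.
  apply: open_continuous_measurable_rV => [|x _]; first exact: openT.
  apply: (@continuous_comp _ _ _ T (fun v : 'rV[R]_n => v ord0 i)).
    exact: strict_diff_continuous (dT x).
  exact: coord_continuous.
have TU' : T @^-1` U = setT by apply/seteqP; split => // x _ /=; exact: TU.
have mFT : measurable_fun [set: 'rV[R]_n] (F \o T).
  by apply: (measurable_comp mU) => // _ [x _ <-].
rewrite -(ge0_integral_density lam mJ J_ge0 mFT) => [|x]; last exact: F0.
rewrite -TU' -(@ge0_integral_pushforward _ _ _ _ _ _ mT mu U F)//; last first.
  by move=> y /set_mem; exact: F0.
apply: eq_measure_integral => E mE EU.
rewrite -[RHS]/(mu (T @^-1` E)) -[RHS]lebesgue_image; last first.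
  by rewrite -[X in measurable X]setTI; exact: mT.
congr (lam _); apply/seteqP; split => y /=.
  by move=> Ey; split; [exact: EU|rewrite /= SK//; exact: EU].
by move=> [Uy]; rewrite /= SK.
Qed.

End change_of_variables.

(** * The boundary of a convex set is negligible *)

Section convex_boundary.
Context (R : realType) (n : nat).
Local Notation lam := (lebesgue_rV R n).
Implicit Types x y z u v : 'rV[R]_n.
Variables (D : set 'rV[R]_n) (y0 : 'rV[R]_n).
Hypothesis mD : measurable D.
Hypothesis cD : forall x y (t : R), 0 < t < 1 -> D x -> D y -> D (t *: x + (1 - t) *: y).
Hypothesis D0 : D° y0.

(** If [D] contains the ball of radius [r] about [y0], then it contains the
    ball of radius [(1 - t) * r] about the point at ratio [t] between [y0] and
    [x]. *)
Lemma homothety_interior x (t : R) : 0 < t < 1 -> D x -> D° (y0 + t *: (x - y0)).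
Proof.
move=> /andP[t0 t1] Dx; set z := y0 + _.
have /nbhs_ballP[r /= r0 rD] : nbhs y0 D := D0.
have t1' : 0 < 1 - t by rewrite subr_gt0.
apply/nbhs_ballP; exists ((1 - t) * r) => /= [|u]; first exact: mulr_gt0.
rewrite -ball_normE /ball_ /= => zu.
pose v := (1 - t)^-1 *: (u - t *: x).
have -> : u = t *: x + (1 - t) *: v.
  by rewrite scalerA divff ?gt_eqF// scale1r addrC subrK.
apply: cD => //; first by rewrite t0.
apply: rD; rewrite -ball_normE /ball_ /=.
have -> : y0 - v = (1 - t)^-1 *: (z - u).
  apply/rowP => i; rewrite !mxE; field; rewrite gt_eqF//.
by rewrite normrZ gtr0_norm ?invr_gt0// ltr_pdivrMl.
Qed.

Let measurable_interior : measurable D°.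
Proof. by apply: open_measurable_rV; exact: open_interior. Qed.

Let Ball (k : nat) := [set x | `|x - y0| < k%:R].

Let mBall k : measurable (Ball k).
Proof.
apply: open_measurable_rV; rewrite openE => x Bx.
apply/nbhs_ballP; exists (k%:R - `|x - y0|); first by rewrite /= subr_gt0.
move=> u; rewrite -ball_normE /ball_ /= distrC ltrBrDr => xu.
by apply: le_lt_trans xu; rewrite (_ : u - y0 = (u - x) + (x - y0)) ?ler_normD// addrA subrK.
Qed.

Let lamBall k : (lam (D `&` Ball k) < +oo)%E.
Proof.
apply: (@le_lt_trans _ _ (lam (obox (y0 - const_mx k%:R) (y0 + const_mx k%:R)))).
  apply: le_lebesgue_rV; [exact: measurableI|exact: measurable_obox|].
  move=> x [_ Bx] i; have := le_lt_trans (rV_norm_coord (x - y0) i) Bx.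
  by rewrite !mxE ltr_norml => /andP[? ?]; apply/andP; split; lra.
have H : forall i, (y0 - const_mx k%:R) ord0 i <= (y0 + const_mx k%:R) ord0 i.
  by move=> i; rewrite !mxE lerD2l ge0_cp.
by rewrite lebesgue_rV_obox// ltry.
Qed.

Let bernoulli (s : R) m : 0 < s -> s < 1 -> 1 - m%:R * s <= (1 - s) ^+ m.
Proof.
move=> s0 s1; elim: m => [|m IH]; first by rewrite mul0r subr0 expr0.
rewrite exprS; apply: (@le_trans _ _ ((1 - s) * (1 - m%:R * s))); last first.
  by rewrite ler_pM2l ?subr_gt0.
have : 0 <= m%:R * s * s by rewrite !mulr_ge0// ltW.
by rewrite -natr1; lra.
Qed.

Let boundary_ball k : lam ((D `\` D°) `&` Ball k) = 0%E.
Proof.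
set E := _ `&` _; set M := lam (D `&` Ball k).
have mE : measurable E by apply: measurableI => //; exact: measurableD.
have Mfin : M \is a fin_num by rewrite ge0_fin_numE ?measure_ge0//; exact: lamBall.
have EM (s : R) : 0 < s -> s < 1 -> (lam E + ((1 - s) ^+ n)%:E * M <= M)%E.
  move=> s0 s1.
  have t01 : 0 < 1 - s < 1 by rewrite subr_gt0 s1 ltrBlDr ltrDl.
  have /andP[t0 t1] := t01.
  pose F := (fun u => u + y0) @^-1` (D `&` Ball k).
  have mDB : measurable (D `&` Ball k) by exact: measurableI.
  have mF : measurable F by rewrite -[X in measurable X]setTI; exact: measurable_rVD.
  have uT : ((1 - s)%:M : 'M[R]_n) \in unitmx.
    by rewrite unitmxE det_scalar unitfE expf_neq0// gt_eqF.
  pose H := (fun x => (x - y0) *m invmx (1 - s)%:M) @^-1` F.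
  have mH : measurable H by exact: measurable_affine_preimage.
  have -> : (((1 - s) ^+ n)%:E * M)%E = lam H.
    by rewrite lebesgue_rV_affine// det_scalar ger0_norm ?exprn_ge0 ?(ltW t0)// lebesgue_rVD.
  have HE x : H x -> exists2 z, (D `&` Ball k) z & x = y0 + (1 - s) *: (z - y0).
    move=> Hx; exists ((x - y0) *m invmx (1 - s)%:M + y0) => //.
    rewrite addrK invmx_scalar mul_mx_scalar scalerA divff ?gt_eqF// scale1r.
    by rewrite addrC subrK.
  rewrite -measureU//; last first.
    apply/seteqP; split => // x [[[_ nDx] _] /HE[z [Dz _] xz]].
    by apply: nDx; rewrite xz; exact: homothety_interior.
  apply: le_lebesgue_rV; [exact: measurableU|exact: measurableI|].
  move=> x [[[Dx _] Bx]//|/HE[z [Dz Bz] ->]]; split.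
    by apply: interior_subset; exact: homothety_interior.
  rewrite /Ball /= addrAC subrr add0r normrZ gtr0_norm//.
  by apply: le_lt_trans Bz; rewrite ler_piMl// ltW.
have Efin : lam E \is a fin_num.
  rewrite ge0_fin_numE ?measure_ge0//; apply: le_lt_trans (lamBall k).
  apply: le_lebesgue_rV => //; first exact: measurableI.
  by move=> x [[Dx _] Bx].
rewrite -(fineK Mfin) -(fineK Efin) in EM *.
set e := fine _ in EM *; set m := fine _ in EM *.
have m0 : 0 <= m by rewrite fine_ge0// measure_ge0.
have e0 : 0 <= e by rewrite fine_ge0// measure_ge0.
congr (_%:E); apply/le_anti; rewrite e0 andbT leNgt; apply/negP => ep.
(* Bernoulli's inequality turns [EM] into [e <= n * s * m] for all small [s]. *)
pose s := Num.min (2^-1) (e / (n%:R * m + 1) / 2).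
have nm : 0 < n%:R * m + 1 by rewrite ltr_wpDl// mulr_ge0.
have s0 : 0 < s by rewrite lt_min invr_gt0 ltr0n/= !divr_gt0.
have s1 : s < 1 by rewrite gt_min invf_lt1 ?ltr1n.
have s2 : s <= e / (n%:R * m + 1) / 2 by rewrite ge_min lexx orbT.
have s3 : s * (n%:R * m + 1) <= e / 2.
  by move: s2; rewrite mulrAC ler_pdivlMr.
have := EM s s0 s1; rewrite -EFinM -EFinD lee_fin.
have := ler_wpM2r m0 (bernoulli n s0 s1).
lra.
Qed.

(** A homothety of ratio [t < 1] centred at an interior point maps [D] into its
    interior. Within a ball, the non-interior points of [D] and the image of
    [D] are therefore disjoint parts of [D], and the measure of the latter tends
    to that of [D] as [t] tends to 1. *)
Lemma convex_boundary_null : lam (D `\` D°) = 0%E.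
Proof.
have -> : D `\` D° = \bigcup_k ((D `\` D°) `&` Ball k).
  apply/seteqP; split => x; last by move=> [k _ []].
  move=> Dx; exists (Num.truncn `|x - y0|).+1 => //; split => //.
  exact: truncnS_gt.
apply/eqP; rewrite -measure_le0.
apply: le_trans (measure_sigma_subadditive _ _ _ (@subset_refl _ _)) _ => //.
- by move=> k; apply: measurableI => //; exact: measurableD.
- by apply: bigcup_measurable => k _; apply: measurableI => //; exact: measurableD.
- by rewrite eseries0// => k _ _; exact: boundary_ball.
Qed.

End convex_boundary.

(** * C^2 functions and logarithms *)

Section C2_functions.
Context (R : realType) (n : nat).
Implicit Types (x y z v : 'rV[R]_n) (g psi : 'rV[R]_n -> R).

Lemma line_is_derive g x v c :
  is_derive (0 : R) (1 : R) (fun s => g (x + s *: v)) c -> is_derive x v g c.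
Proof.
have E : (fun h : R => h^-1 *: (((fun s => g (x + s *: v)) \o shift 0) (h *: (1 : R)) -
      g (x + 0 *: v))) =
    (fun h : R => h^-1 *: ((g \o shift x) (h *: v) - g x)).
  apply/funext => h /=; congr (_ *: (g _ - g _)); last by rewrite scale0r addr0.
  by rewrite [h *: 1]mulr1 addr0 addrC.
by move=> [d1 d2]; split; rewrite /derivable /derive -E.
Qed.

Lemma is_derive_neg_ln g x v : derivable g x v -> 0 < g x ->
  is_derive x v (fun y => - ln (g y)) (- ((g x)^-1 * 'D_v g x)).
Proof.
move=> dg gx; apply: line_is_derive.
have dl : is_derive (0 : R) (1 : R) (fun s => g (x + s *: v)) ('D_v g (x + 0 *: v)).
  by apply: is_derive_line; rewrite scale0r addr0.
have gx' : 0 < (fun s : R => g (x + s *: v)) 0 by rewrite scale0r addr0.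
have := is_derive1_comp (is_derive1_ln gx') dl; rewrite scale0r addr0 => dln.
exact: is_deriveN.
Qed.

(** The gradient formula is part of the statement because it relates the
    expression for the divergence, in terms of the function, to the potential. *)
Lemma C2_on_neg_ln A g : (forall x, A x -> 0 < g x) -> C2_on A g ->
  C2_on A (fun x => - ln (g x)) /\
  (forall x, A° x -> forall i, partial i (fun x => - ln (g x)) x = - ((g x)^-1 * partial i g x)).
Proof.
move=> gA C2g.
have gA' x : A° x -> 0 < g x by move=> /interior_subset/gA.
have cg x : A° x -> {for x, continuous g} by move=> /C2g[].
have cgV x : A° x -> {for x, continuous (fun y => (g y)^-1)}.
  by move=> Ax; apply: continuousV; [rewrite gt_eqF// gA'|exact: cg].
have dg x : A° x -> forall i, derivable g x (delta_mx ord0 i).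
  by move=> /C2g[_ [H _]] i; exact: (H i).1.
have cdg x : A° x -> forall i, {for x, continuous (partial i g)}.
  by move=> /C2g[_ [H _]] i; exact: (H i).2.
have ddg x : A° x -> forall i j, derivable (partial j g) x (delta_mx ord0 i).
  by move=> /C2g[_ [_ H]] i j; exact: (H i j).1.
have cddg x : A° x -> forall i j, {for x, continuous (partial i (partial j g))}.
  by move=> /C2g[_ [_ H]] i j; exact: (H i j).2.
have nA x : A° x -> \forall y \near x, A° y.
  by move=> Ax; apply: open_nbhs_nbhs; split => //; exact: open_interior.
have pE x : A° x -> forall i, partial i (fun x => - ln (g x)) x = - ((g x)^-1 * partial i g x).
  move=> Ax i; rewrite /partial.
  by rewrite (@derive_val _ _ _ _ _ _ _ (is_derive_neg_ln (dg _ Ax i) (gA' _ Ax))).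
pose F j := (fun y => (g y)^-1) * partial j g : 'rV[R]_n -> R.
have dF x : A° x -> forall i j, derivable (F j) x (delta_mx ord0 i).
  move=> Ax i j; apply: derivableM; last exact: ddg.
  by apply: derivableV; [rewrite gt_eqF// gA'|exact: dg].
have FE x : A° x -> forall i j, 'D_(delta_mx ord0 i) (F j) x =
    (g x)^-1 * partial i (partial j g) x - partial j g x * (g x ^- 2 * partial i g x).
  move=> Ax i j; rewrite deriveM; last 2 first.
  - by apply: derivableV; [rewrite gt_eqF// gA'|exact: dg].
  - exact: ddg.
  rewrite deriveV; last 2 first.
  - by rewrite gt_eqF// gA'.
  - exact: dg.
  by rewrite /partial /GRing.scale/= mulNr mulrN.
split; last exact: pE.
move=> x Ax.
have pEn i : \forall y \near x, - F i y = partial i (fun x => - ln (g x)) y.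
  by apply: filterS (nA _ Ax) => y Ay; rewrite pE.
have H (h k : 'rV[R]_n -> R) : (\forall y \near x, h y = k y) ->
    {for x, continuous h} -> {for x, continuous k}.
  move=> hk ch; rewrite /prop_for /continuous_at -(nbhs_singleton hk).
  by move=> V /ch; apply: filterS2 hk => y /= -> .
split; last split.
- have cln : {for x, continuous (@ln R \o g)}.
    by apply: continuous_comp; [exact: cg|exact/continuous_ln/gA'].
  exact: (continuousN cln).
- move=> i; split.
    exact: (@ex_derive _ _ _ _ _ _ _ (is_derive_neg_ln (dg _ Ax i) (gA' _ Ax))).
  by apply: H (pEn i) _; exact: (continuousN (continuousM (cgV _ Ax) (cdg _ Ax i))).
- move=> i j; split.
    by apply: near_eq_derivable (pEn j) _; apply: derivableN; exact: dF.
  have : \forall y \near x, - ((g y)^-1 * partial i (partial j g) y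
      - partial j g y * ((g y)^-1 * (g y)^-1 * partial i g y)) =
      partial i (partial j (fun x => - ln (g x))) y.
    apply: filterS (nA _ Ax) => y Ay; rewrite [RHS]/partial.
    rewrite -(@near_eq_derive _ _ _ (- F j)); last first.
      by apply: filterS (nA _ Ay) => z Az; rewrite [RHS]pE.
    rewrite deriveN; last exact: dF. rewrite (FE _ Ay i j).
    by field; rewrite gt_eqF// gA'.
  move=> /H; apply; apply: continuousN.
  apply: (continuousB (continuousM (cgV _ Ax) (cddg _ Ax i j))).
  apply: (continuousM (cdg _ Ax j)).
  exact: (continuousM (continuousM (cgV _ Ax) (cgV _ Ax)) (cdg _ Ax i)).
Qed.

Definition gradient_strict psi x := forall e, 0 < e ->
  \forall d \near (0:R)^'+, forall y z, `|y - x| < d -> `|z - x| < d ->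
    `|psi y - psi z - dot (y - z) (grad psi x)| <= e * `|y - z|.

Lemma C2_on_strict A psi x : C2_on A psi -> A° x -> gradient_strict psi x.
Proof.
move=> C2 Ax e e0.
have nA : \forall y \near x, A° y.
  by apply: open_nbhs_nbhs; split => //; exact: open_interior.
have : \forall y \near x, forall i, derivable psi y (delta_mx ord0 i).
  by apply: filterS nA => y /C2[_ [H _]] i; exact: (H i).1.
move=> /partial_strict/(_ _ e e0).
have c i : {for x, continuous (partial i psi)} by have [_ [H _]] := C2 _ Ax; exact: (H i).2.
move=> /(_ c); apply: filterS => d H y z yx zx.
rewrite /dot; under eq_bigr do rewrite [grad _ _ _ _]mxE.
exact: H.
Qed.

Lemma C2_on_grad_strict A psi x : C2_on A psi -> A° x ->
  strict_diff (grad psi) x (Hess psi x).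
Proof.
move=> C2 Ax.
have gE j : (fun x => grad psi x ord0 j) = partial j psi.
  by apply/funext => y; rewrite mxE.
have nA : \forall y \near x, A° y.
  by apply: open_nbhs_nbhs; split => //; exact: open_interior.
have := @partial_strict_diff R n n (grad psi) x.
rewrite (_ : \matrix_(i, j) _ = Hess psi x); last first.
  by apply/matrixP => i j; rewrite !mxE gE.
apply.
  by apply: filterS nA => y /C2[_ [_ H]] i j; rewrite gE; exact: (H i j).1.
by move=> i j; rewrite gE; have [_ [_ H]] := C2 _ Ax; exact: (H i j).2.
Qed.

Lemma C2_on_det_continuous A psi x : C2_on A psi -> A° x ->
  {for x, continuous (fun y => \det (Hess psi y))}.
Proof.
move=> C2 Ax; rewrite /prop_for /continuous_at /determinant.
have FF : Filter (nbhs x) by exact: nbhs_filter.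
apply: (@cvg_big _ _ _ _ _ _ _ (nbhs x) _ _ _ FF) => [|s _]; first exact: add_continuous.
apply: (@cvgM _ _ (nbhs x) FF); first exact: cvg_cst.
apply: (@cvg_big _ _ _ _ _ _ _ (nbhs x) _ _ _ FF) => [|i _]; first exact: mul_continuous.
under eq_fun do rewrite mxE.
rewrite mxE; have [_ [_ H]] := C2 _ Ax; exact: (H _ _).2.
Qed.

End C2_functions.

(** * Gradients of strictly convex functions *)

Section dot_product.
Context (R : realType) (n : nat).
Implicit Types u v w : 'rV[R]_n.

Lemma dotC u v : dot u v = dot v u.
Proof. by apply: eq_bigr => i _; rewrite mulrC. Qed.

Lemma dotDl u v w : dot (u + v) w = dot u w + dot v w.
Proof. by rewrite /dot -big_split/=; apply: eq_bigr => i _; rewrite mxE mulrDl. Qed.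

Lemma dotZl (a : R) u v : dot (a *: u) v = a * dot u v.
Proof. by rewrite /dot mulr_sumr; apply: eq_bigr => i _; rewrite mxE mulrA. Qed.

Lemma dotNl u v : dot (- u) v = - dot u v.
Proof. by rewrite -scaleN1r dotZl mulN1r. Qed.

Lemma dotBl u v w : dot (u - v) w = dot u w - dot v w.
Proof. by rewrite dotDl dotNl. Qed.

Lemma dotBr u v w : dot w (u - v) = dot w u - dot w v.
Proof. by rewrite dotC dotBl !(dotC w). Qed.

Lemma dot_ge0 v : 0 <= dot v v.
Proof. by apply: sumr_ge0 => i _; rewrite -expr2 sqr_ge0. Qed.

Lemma dot_le0 v : dot v v <= 0 -> v = 0.
Proof.
move=> v0; apply/rowP => i; rewrite mxE; apply/eqP.
have /eqP : dot v v = 0 by apply/le_anti; rewrite v0 dot_ge0.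
rewrite /dot psumr_eq0 => [/allP/(_ i)|j _]; last by rewrite -expr2 sqr_ge0.
by rewrite mem_index_enum -expr2 sqrf_eq0; apply.
Qed.

Lemma dot_norm_le u v : `|dot u v| <= n%:R * (`|u| * `|v|).
Proof.
apply: le_trans (ler_norm_sum _ _ _) _.
apply: (@le_trans _ _ (\sum_(i < n) `|u| * `|v|)); last first.
  by rewrite sumr_const card_ord mulr_natl.
apply: ler_sum => i _.
by rewrite normrM ler_pM ?rV_norm_coord.
Qed.

Lemma dot_continuous v : continuous (fun u => dot u v).
Proof.
move=> u; have FF : Filter (nbhs u) by exact: nbhs_filter.
rewrite /prop_for /continuous_at /dot.
apply: (@cvg_big _ _ _ _ _ _ _ (nbhs u) _ _ _ FF) => [|i _]; first exact: add_continuous.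
by apply: (@cvgM _ _ (nbhs u) FF); [exact: coord_continuous|exact: cvg_cst].
Qed.

End dot_product.

Section convex_gradient.
Context (R : realType) (n : nat) (psi : 'rV[R]_n -> R).
Implicit Types x y z u v : 'rV[R]_n.

(** A linear minorant that touches a differentiable function at [x] has slope
    its gradient. Applied to a potential and to its conjugate, this identifies
    the points where the Fenchel-Young inequality is an equality. *)
Lemma subgradient_grad x c : gradient_strict psi x ->
  (\forall z \near x, psi x + dot (z - x) c <= psi z) -> grad psi x = c.
Proof.
move=> gs; rewrite -nbhs_nearE => /nbhs_ballP[r /= r0 xr].
pose v := c - grad psi x.
have v1 : 0 < `|v| + 1 by rewrite ltr_wpDl.
suff /eqP : v = 0 by rewrite subr_eq0 => /eqP.
apply: dot_le0; apply/ler_addgt0Pr => e e0; rewrite add0r.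
have e1 : 0 < e / (`|v| + 1) by rewrite divr_gt0.
have [d d0 H] := near_right_ex (gs _ e1).
pose s := Num.min d r / 2 / (`|v| + 1).
have m0 : 0 < Num.min d r by rewrite lt_min d0.
have s0 : 0 < s by rewrite !divr_gt0.
have sv : `|s *: v| < Num.min d r.
  rewrite normrZ gtr0_norm// /s mulrAC ltr_pdivrMr// ltr_pM//=; lra.
move: sv; rewrite lt_min => /andP[svd svr].
have /xr : ball x r (x + s *: v).
  by rewrite -ball_normE /ball_ /= opprD addrA subrr add0r normrN.
have xx : `|x - x| < d by rewrite subrr normr0.
have svx : x + s *: v - x = s *: v by rewrite addrAC subrr add0r.
have := H (x + s *: v) x; rewrite svx => /(_ svd xx).
rewrite normrZ gtr0_norm// !dotZl ler_norml => /andP[_ h1] h2.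
have : s * dot v v <= s * (e / (`|v| + 1) * `|v|).
  have -> : dot v v = dot v c - dot v (grad psi x) by rewrite -dotBr.
  by lra.
rewrite ler_pM2l// => /le_trans; apply.
rewrite mulrAC ler_pdivrMr// ler_pM2l//; lra.
Qed.

Hypothesis sc : strictly_convex psi.

Lemma gradient_inequality x z : gradient_strict psi x ->
  psi x + dot (z - x) (grad psi x) <= psi z.
Proof.
move=> gs; have [->|zx] := eqVneq z x.
  by rewrite subrr /dot big1 ?addr0// => i _; rewrite mxE mul0r.
have zx0 : 0 < `|z - x| by rewrite normr_gt0 subr_eq0.
apply/ler_addgt0Pr => e e0.
have [d d0 H] := near_right_ex (gs _ (divr_gt0 e0 zx0)).
pose t := Num.min (d / 2 / `|z - x|) 2^-1.
have t0 : 0 < t by rewrite lt_min invr_gt0 ltr0n !divr_gt0.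
have t1 : t < 1 by rewrite gt_min; apply/orP; right; lra.
have td : t * `|z - x| < d.
  apply: (@le_lt_trans _ _ (d / 2)); last lra.
  by rewrite -ler_pdivlMr// ge_min lexx.
have t01 : 0 < t < 1 by rewrite t0.
have := sc t01 zx.
have -> : t *: z + (1 - t) *: x = x + t *: (z - x).
  by apply/rowP => i; rewrite !mxE; ring.
have xx : `|x - x| < d by rewrite subrr normr0.
have svx : x + t *: (z - x) - x = t *: (z - x) by rewrite addrAC subrr add0r.
have := H (x + t *: (z - x)) x; rewrite svx normrZ gtr0_norm// => /(_ td xx).
rewrite dotZl (_ : e / `|z - x| * (t * `|z - x|) = t * e); last first.
  by field; rewrite gt_eqF.
rewrite ler_norml => /andP[h1 _] h2.
by rewrite -(ler_pM2l t0); lra.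
Qed.

Hypothesis gs : forall x, gradient_strict psi x.

Lemma gradient_inequality_strict x z : z != x ->
  psi x + dot (z - x) (grad psi x) < psi z.
Proof.
move=> zx; have h : 0 < (2^-1 : R) < 1 by apply/andP; split; lra.
have := sc h zx; have := gradient_inequality (2^-1 *: z + (1 - 2^-1) *: x) (gs x).
have -> : 2^-1 *: z + (1 - 2^-1) *: x - x = 2^-1 *: (z - x).
  by apply/rowP => i; rewrite !mxE; ring.
by rewrite dotZl; lra.
Qed.

Hypothesis cpsi : continuous psi.

Lemma compact_norm (C : set R) : closed C -> (exists M, forall t, C t -> t <= M) ->
  compact [set u : 'rV[R]_n | C `|u|].
Proof.
move=> cC [M CM]; apply: bounded_closed_compact.
  exists M; split; first exact: num_real.
  by move=> N MN u /CM uM; apply: le_trans uM (ltW MN).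
by apply: (@preimage_closed _ _ (fun u : 'rV[R]_n => `|u|)) => // u _; exact: norm_continuous.
Qed.

(** After subtraction of its tangent at [x], [psi] is positive on the unit
    sphere about [x], hence bounded below there by some [c > 0] by compactness,
    and outside the sphere it grows at least linearly by convexity. *)
Lemma gradient_coercive x : exists2 c : R, 0 < c & forall u,
  psi x + dot u (grad psi x) + c * (`|u| - 1) <= psi (x + u).
Proof.
pose G u := psi (x + u) - psi x - dot u (grad psi x).
have G0 u : 0 <= G u.
  have := gradient_inequality (x + u) (gs x).
  by rewrite addrAC subrr add0r /G; lra.
have cG : continuous G.
  move=> u.
  have cx : {for u, continuous (fun u => x + u)}.
    by apply: (continuousD (@cst_continuous _ _ x u)) => V.
  have c1 : {for u, continuous (psi \o (fun u => x + u))}.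
    by apply: continuous_comp => //; exact: cpsi.
  by apply: (continuousB (continuousB c1 (@cst_continuous _ _ (psi x) u)))
    (@dot_continuous _ _ (grad psi x) u).
pose S := [set u : 'rV[R]_n | [set (1:R)] `|u|].
have [c c0 cS] : exists2 c : R, 0 < c & forall u, `|u| = 1 -> c <= G u.
  (* The sphere is empty when [n = 0]. *)
  have [S0|S0] := pselect (S !=set0); last first.
    by exists 1 => // u u1; exfalso; apply: S0; exists u.
  have cS : compact S.
    apply: compact_norm; first exact: closed_eq.
    by exists 1 => t /= ->.
  have [u /set_mem u1 Gu] := EVT_min_rV S0 cS (continuous_subspaceT cG).
  exists (G u); last by move=> w w1; apply: Gu; exact: mem_set.
  have xu : x + u != x.
    rewrite -subr_eq0 addrAC subrr add0r -normr_eq0 u1 oner_neq0//.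
  have := gradient_inequality_strict xu.
  by rewrite addrAC subrr add0r /G; lra.
exists c => // u; suff : c * (`|u| - 1) <= G u by rewrite /G; lra.
have [u1|u1] := leP `|u| 1.
  by apply: le_trans (G0 u); rewrite mulr_ge0_le0 ?subr_le0// ltW.
have u0 : 0 < `|u| by lra.
pose w := `|u|^-1 *: u.
have w1 : `|w| = 1 by rewrite normrZ gtr0_norm ?invr_gt0// mulVf ?gt_eqF.
have := cS _ w1; rewrite /G.
have t01 : 0 < `|u|^-1 < 1 by rewrite invr_gt0 u0 invf_lt1.
have xu : x + u != x.
  by rewrite -subr_eq0 addrAC subrr add0r -normr_eq0 gt_eqF.
have := sc t01 xu.
have -> : `|u|^-1 *: (x + u) + (1 - `|u|^-1) *: x = x + w.
  by apply/rowP => i; rewrite !mxE; ring.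
rewrite dotZl => h1 h2.
have : `|u|^-1 * (c * (`|u| - 1)) <= `|u|^-1 * (psi (x + u) - psi x - dot u (grad psi x)).
  have -> : `|u|^-1 * (c * (`|u| - 1)) = c * (1 - `|u|^-1) by field; rewrite gt_eqF.
  have : 0 < c * `|u|^-1 by rewrite mulr_gt0// invr_gt0.
  by lra.
by rewrite ler_pM2l ?invr_gt0.
Qed.

End convex_gradient.

(** * The dual function *)

Section dual_function.
Context (R : realType) (n : nat) (psi : 'rV[R]_n -> R).
Implicit Types x y z u v : 'rV[R]_n.
Let phi x := expR (- psi x).

Let dualE y : dual phi y = inf [set expR (psi z - dot y z) | z in [set: 'rV[R]_n]].
Proof.
have E z : expR (- dot y z) / phi z = expR (psi z - dot y z).
  by rewrite /phi -expRN opprK -expRD addrC.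
by rewrite /dual; congr inf; apply/seteqP; split => _ [z _ <-]; exists z.
Qed.

Let has_inf_dual y : has_inf [set expR (psi z - dot y z) | z in [set: 'rV[R]_n]].
Proof.
split; first by exists (expR (psi 0 - dot y 0)), 0.
by exists 0 => _ [z _ <-]; rewrite expR_ge0.
Qed.

Lemma expR_le_dual c y : (forall z, c <= psi z - dot y z) -> expR c <= dual phi y.
Proof.
move=> H; rewrite dualE; apply: lb_le_inf; first exact: (has_inf_dual y).1.
by move=> _ [z _ <-]; rewrite ler_expR.
Qed.

Lemma dual_le_expR y z : dual phi y <= expR (psi z - dot y z).
Proof. by rewrite dualE; apply: ge_inf; [exact: (has_inf_dual y).2|exists z]. Qed.

(** The support of the dual function is the domain of the conjugate of
    [psi]. *)
Lemma supp_dualP y : supp (dual phi) y <-> exists c, forall z, c <= psi z - dot y z.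
Proof.
split=> [y0|[c H]]; last by apply: lt_le_trans (expR_le_dual H); exact: expR_gt0.
exists (ln (dual phi y)) => z; rewrite -ler_expR lnK//; exact: dual_le_expR.
Qed.

Lemma supp_dual_convex x y (t : R) : 0 < t < 1 -> supp (dual phi) x ->
  supp (dual phi) y -> supp (dual phi) (t *: x + (1 - t) *: y).
Proof.
move=> /andP[t0 t1] /supp_dualP[c cP] /supp_dualP[d dP]; apply/supp_dualP.
exists (t * c + (1 - t) * d) => z; rewrite dotDl !dotZl.
have := ler_wpM2l (ltW t0) (cP z).
have t1' : 0 <= 1 - t by rewrite subr_ge0 ltW.
have := ler_wpM2l t1' (dP z); lra.
Qed.

Lemma dual_attained x y : (forall z, psi x - dot y x <= psi z - dot y z) ->
  dual phi y = expR (psi x - dot y x).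
Proof.
by move=> H; apply/le_anti; rewrite dual_le_expR expR_le_dual.
Qed.

(** The Fenchel-Young inequality, [- ln (dual phi)] being the conjugate of
    [psi]. *)
Lemma conjugate_ge y z : supp (dual phi) y -> dot y z - psi z <= - ln (dual phi y).
Proof.
move=> y0; rewrite -opprB lerN2 -ler_expR lnK//; exact: dual_le_expR.
Qed.

Hypothesis sc : strictly_convex psi.
Hypothesis gs : forall x, gradient_strict psi x.
Hypothesis cpsi : continuous psi.

(** The case of equality in the Fenchel-Young inequality. *)
Lemma dual_grad x : dual phi (grad psi x) = expR (psi x - dot (grad psi x) x).
Proof.
apply: dual_attained => z; have := gradient_inequality sc z (gs x).
by rewrite dotC dotBr; lra.
Qed.

(** The linear growth of [psi] above its tangent at [x] absorbs a small change
    of slope, so the conjugate is finite near [grad psi x]. *)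
Lemma grad_interior x : (supp (dual phi))° (grad psi x).
Proof.
have [c c0 cP] := gradient_coercive sc gs cpsi x.
have n1 : 0 < (n.+1%:R : R) by rewrite ltr0n.
apply/nbhs_ballP; exists (c / n.+1%:R) => /= [|y]; first exact: divr_gt0.
rewrite -ball_normE /ball_ /= ltr_pdivlMr// => xy.
apply/supp_dualP; exists (psi x - dot y x - c) => z.
have := cP (z - x); rewrite [x + _]addrC subrK.
have := dot_norm_le (grad psi x - y) (z - x).
have : n%:R * (`|grad psi x - y| * `|z - x|) <= c * `|z - x|.
  rewrite mulrA ler_wpM2r// mulrC; apply: le_trans (ltW xy).
  by rewrite ler_wpM2l// ler_nat.
rewrite ler_norml !dotBl !dotBr [dot z _]dotC [dot x _]dotC.
by move=> h1 /andP[h2 h3] h4; lra.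
Qed.

(** The conjugate is finite at the points [y + s e_i] and [y - s e_i] for small
    [s], which forces [psi - dot y] to grow linearly in every direction. It
    therefore attains its minimum, and there the gradient of [psi] is [y]. *)
Lemma grad_surjective y : (supp (dual phi))° y -> exists x, grad psi x = y.
Proof.
move=> Dy; have /nbhs_ballP[r /= r0 rD] : nbhs y (supp (dual phi)) := Dy.
pose G z := psi z - dot y z.
pose d := r / 2.
have d0 : 0 < d by rewrite divr_gt0.
have [C CP] : exists C, forall z, d * `|z| + C <= G z.
  (* Finiteness of the conjugate at [y + d e_i] and [y - d e_i]. *)
  have H i : exists C, forall z, d * `|z ord0 i| + C <= G z.
    have Hs (s : R) : `|s| <= d -> exists C, forall z, s * z ord0 i + C <= G z.
      move=> sd; have : supp (dual phi) (y + s *: delta_mx ord0 i).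
        apply: rD; rewrite -ball_normE /ball_ /= opprD addrA subrr add0r normrN.
        apply/rV_norm_ltP => // j; rewrite !mxE eqxx /=.
        apply: (@le_lt_trans _ _ d); last by rewrite /d; lra.
        by case: (j == i); rewrite ?mulr1 ?mulr0 ?normr0// ltW.
      move=> /supp_dualP[C CP]; exists C => z; have := CP z.
      rewrite dotDl dotZl (_ : dot (delta_mx ord0 i) z = z ord0 i) /G; first by lra.
      rewrite /dot (bigD1 i)//= big1 => [|j ji]; first by rewrite mxE !eqxx mul1r addr0.
      by rewrite mxE eqxx (negbTE ji) mul0r.
    have [|C1 H1] := Hs d; first by rewrite gtr0_norm.
    have [|C2 H2] := Hs (- d); first by rewrite normrN gtr0_norm.
    exists (Num.min C1 C2) => z; have := H1 z; have := H2 z.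
    have : Num.min C1 C2 <= C1 by rewrite ge_min lexx.
    have : Num.min C1 C2 <= C2 by rewrite ge_min lexx orbT.
    by case: ger0P => zi; lra.
  (* [c0] covers the case where there is no coordinate at all. *)
  have [c0 c0P] := (supp_dualP y).1 (interior_subset Dy).
  pose Cf i := sval (cid (H i)).
  have [C C0 CC] : exists2 C, C <= c0 & forall i, C <= Cf i.
    exists (\big[Num.min/c0]_i Cf i) => [|i]; first exact: bigmin_le_id.
    exact: bigmin_le_cond.
  exists C => z; have [z0|z0] := eqVneq `|z| 0.
    by rewrite z0 mulr0 add0r; apply: le_trans C0 (c0P z).
  have [[i j] zi] := mx_norm_neq0 z0.
  have := svalP (cid (H j)) z; rewrite -/(Cf j).
  rewrite [`|z|]zi /= (ord1 i); have := CC j; lra.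
(* Outside the ball of radius [M] the linear bound exceeds [G 0]. *)
pose M := (`|G 0| + `|C|) / d + 1.
have M0 : 0 < M by rewrite ltr_wpDl// divr_ge0// ?ltW// addr_ge0.
have cG : continuous G.
  have -> : G = psi \- (fun u => dot u y) by apply/funext => u; rewrite /G dotC.
  by move=> z; exact: (continuousB (@cpsi z) (@dot_continuous _ _ y z)).
have cS : compact [set u : 'rV[R]_n | [set t : R | t <= M] `|u|].
  by apply: compact_norm; [exact: closed_le|exists M].
have S0 : [set u : 'rV[R]_n | [set t : R | t <= M] `|u|] !=set0.
  by exists 0; rewrite /= normr0 ltW.
have [x /set_mem xM Gx] := EVT_min_rV S0 cS (continuous_subspaceT cG).
have Gmin z : G x <= G z.
  have [zM|Mz] := leP `|z| M; first by apply: Gx; exact: mem_set.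
  apply: (@le_trans _ _ (G 0)).
    by apply: Gx; apply: mem_set; rewrite /= normr0 ltW.
  apply: le_trans (CP z); have : d * M < d * `|z| by rewrite ltr_pM2l.
  rewrite /M mulrDr mulrCA divff ?gt_eqF// !mulr1 => h.
  have := ler_norm (G 0); have := ler_norm (- C); rewrite normrN; lra.
exists x; apply: subgradient_grad => //.
apply: filterE => z; have := Gmin z; rewrite /G [dot (z - x) _]dotC dotBr; lra.
Qed.

End dual_function.

(** * Duality of the divergence *)

Section positive_determinant.
Context (R : realType) (n : nat).

(** The determinant does not vanish along the segment from the identity to
    [A], because a vector [v] in the kernel of [(1 - t) I + t A] satisfies
    [(1 - t) |v|^2 + t <v A, v> = 0]. *)
Lemma psd_det_gt0 (A : 'M[R]_n) : A \in unitmx ->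
  (forall v : 'rV[R]_n, 0 <= dot (v *m A) v) -> 0 < \det A.
Proof.
move=> uA A0.
pose M : 'M[{poly R}]_n := (1 - 'X)%:M + 'X *: map_mx polyC A.
have ME t : (\det M).[t] = \det ((1 - t)%:M + t *: A).
  rewrite -horner_evalE -det_map_mx; congr (\det _); apply/matrixP => i j.
  by rewrite !mxE /= horner_evalE !hornerE hornerMn !hornerE.
have nz t : 0 <= t <= 1 -> (\det M).[t] != 0.
  move=> /andP[t0 t1]; rewrite ME; apply/negP => /det0P[v v0].
  rewrite mulmxDr mul_mx_scalar -scalemxAr => vM.
  have : dot ((1 - t) *: v + t *: (v *m A)) v = 0.
    by rewrite vM /dot big1// => i _; rewrite mxE mul0r.
  rewrite dotDl !dotZl => E.
  have t1' : 0 <= 1 - t by rewrite subr_ge0.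
  have [t1E|t1N] := eqVneq t 1.
    move: vM; rewrite t1E subrr scale0r add0r scale1r => vA.
    by move/negP: v0; apply; rewrite -(mulmxK uA v) vA mul0mx.
  have : 0 < (1 - t) by rewrite lt_neqAle t1' andbT eq_sym subr_eq0 eq_sym.
  move=> t1''; move/negP: v0; apply; apply/eqP/dot_le0.
  have := mulr_ge0 t0 (A0 v); rewrite -(pmulr_rle0 _ t1''); lra.
have p0 : (\det M).[0] = 1.
  by rewrite ME subr0 scale0r addr0 det1.
have p1 : (\det M).[1] = \det A by rewrite ME subrr scale1r raddf0 add0r.
rewrite -p1 lt_neqAle eq_sym nz ?ler01 ?lexx//= leNgt; apply/negP => p1n.
have [||t t01] := @poly_ivt R (- \det M) 0 1; first exact: ler01.
  by rewrite !hornerN p0 oppr_le0 ler01 oppr_ge0 ltW.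
by rewrite rootN rootE; apply/negP; exact: nz.
Qed.

End positive_determinant.

Section duality.
Context (R : realType) (n : nat) (f : R -> R) (psi : 'rV[R]_n -> R).
Local Notation lam := (lebesgue_rV R n).
Let phi := fun x => expR (- psi x).

Let supp_phi : supp phi = [set: 'rV[R]_n].
Proof. by apply/seteqP; split => // x _; exact: expR_gt0. Qed.

Let ln_phi : (fun x => - ln (phi x)) = psi.
Proof. by apply/funext => x; rewrite expRK opprK. Qed.

Hypothesis sc : strictly_convex psi.
Hypothesis C2 : C2_on (supp phi) phi.
Hypothesis C2_dual : C2_on (supp (dual phi)) (dual phi).

Let conj y := - ln (dual phi y).
Let U := (supp (dual phi))°.

Let all_interior x : (supp phi)° x.
Proof. by rewrite supp_phi interiorT. Qed.

Let C2psi : C2_on (supp phi) psi.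
Proof. by have [] := C2_on_neg_ln (fun x px => px) C2; rewrite ln_phi. Qed.

Let gradE x i : partial i psi x = - ((phi x)^-1 * partial i phi x).
Proof.
by have [_ /(_ _ (all_interior x) i)] := C2_on_neg_ln (fun x px => px) C2; rewrite ln_phi.
Qed.

Let gs x : gradient_strict psi x.
Proof. exact: C2_on_strict C2psi (all_interior x). Qed.

Let cpsi : continuous psi.
Proof. by move=> x; have [] := C2psi (all_interior x). Qed.

Let C2conj : C2_on (supp (dual phi)) conj.
Proof. by have [] := C2_on_neg_ln (fun x px => px) C2_dual. Qed.

Let conj_gradE y i : U y -> partial i conj y = - ((dual phi y)^-1 * partial i (dual phi) y).
Proof.
by move=> Uy; have [_ /(_ _ Uy i)] := C2_on_neg_ln (fun x px => px) C2_dual.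
Qed.

Let conj_grad x : conj (grad psi x) = dot (grad psi x) x - psi x.
Proof. by rewrite /conj (dual_grad sc gs) expRK opprB. Qed.

(** By the Fenchel-Young inequality, [z |-> dot z x - psi x] is a minorant of
    the conjugate touching it at [grad psi x]. *)
Lemma grad_conj_gradK : cancel (grad psi) (grad conj).
Proof.
move=> x; have Ux : U (grad psi x) := grad_interior sc gs cpsi x.
apply: subgradient_grad; first exact: C2_on_strict C2conj Ux.
have : \forall z \near grad psi x, supp (dual phi) z by [].
apply: filterS => z Dz; have := @conjugate_ge _ _ psi z x Dz.
by rewrite -/(conj z) conj_grad dotBl; lra.
Qed.

Lemma grad_grad_conjK y : U y -> grad psi (grad conj y) = y.
Proof.
move=> Uy; have [x <-] := grad_surjective gs cpsi Uy.
by rewrite grad_conj_gradK.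
Qed.

Let Hess_mul x : Hess psi x *m Hess conj (grad psi x) = 1%:M.
Proof.
apply: (@strict_diff_inverse _ _ (grad psi) (grad conj) x) => [||z].
- exact: C2_on_grad_strict C2psi (all_interior x).
- exact: C2_on_grad_strict C2conj (grad_interior sc gs cpsi x).
- exact: grad_conj_gradK.
Qed.

(** The Hessian is invertible since the gradients are mutually inverse, and
    positive semidefinite since [grad psi] is monotone. *)
Let Hess_det_gt0 x : 0 < \det (Hess psi x).
Proof.
have [uH _] := mulmx1_unit (Hess_mul x).
apply: (psd_det_gt0 uH) => v.
have := C2_on_grad_strict C2psi (all_interior x).
set H := Hess psi x => dT.
have v1 : 0 < n%:R * (`|v| * `|v|) + 1.
  by rewrite ltr_wpDl// !mulr_ge0.
apply/ler_addgt0Pl => e e0.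
have e1 : 0 < e / (n%:R * (`|v| * `|v|) + 1) by rewrite divr_gt0.
have [d d0 Hd] := near_right_ex (dT _ e1).
pose s := d / (`|v| + 1).
have vv : 0 < `|v| + 1 by rewrite ltr_wpDl.
have s0 : 0 < s by rewrite divr_gt0.
have sv : `|x + s *: v - x| < d.
  rewrite addrAC subrr add0r normrZ gtr0_norm// /s mulrAC ltr_pdivrMr//.
  rewrite ltr_pM2l//; lra.
have xx : `|x - x| < d by rewrite subrr normr0.
have := Hd _ _ sv xx.
have -> : x + s *: v - x = s *: v by rewrite addrAC subrr add0r.
set w := _ - _ *m H => wb.
have mono : 0 <= dot (grad psi (x + s *: v) - grad psi x) v.
  have h1 := gradient_inequality sc (x + s *: v) (gs x).
  have h2 := gradient_inequality sc x (gs (x + s *: v)).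
  rewrite (_ : x - (x + s *: v) = - (s *: v)) in h2; last by rewrite opprD addrA subrr add0r.
  rewrite (_ : x + s *: v - x = s *: v) in h1; last by rewrite addrAC subrr add0r.
  rewrite dotNl dotZl in h2; rewrite dotZl in h1.
  rewrite dotBl -(pmulr_rge0 _ s0) mulrBr ![dot (grad _ _) v]dotC; lra.
have wE : grad psi (x + s *: v) - grad psi x = s *: (v *m H) + w.
  by rewrite /w -scalemxAl [RHS]addrC subrK.
rewrite wE dotDl dotZl in mono.
have := dot_norm_le w v; rewrite ler_norml => /andP[_ wv].
rewrite normrZ gtr0_norm// in wb.
have : n%:R * (`|w| * `|v|) <= s * e.
  apply: (@le_trans _ _ (n%:R * (e / (n%:R * (`|v| * `|v|) + 1) * (s * `|v|) * `|v|))).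
    by rewrite ler_wpM2l// ler_wpM2r.
  rewrite [leLHS](_ : _ = s * e * (n%:R * (`|v| * `|v|) / (n%:R * (`|v| * `|v|) + 1))); last first.
    by ring.
  rewrite ger_pMr ?mulr_gt0// ler_pdivrMr//; lra.
by move=> h; rewrite -(pmulr_rge0 _ s0) mulrDr; lra.
Qed.

Let dot_log_grad (g : 'rV[R]_n -> R) y :
  (forall i, partial i (fun z => - ln (g z)) y = - ((g y)^-1 * partial i g y)) ->
  dot (grad g y) y / g y = - dot (grad (fun z => - ln (g z)) y) y.
Proof.
move=> gE; rewrite -dotNl mulrC -dotZl; congr dot; apply/rowP => i.
by rewrite !mxE gE opprK.
Qed.

(** At corresponding points the arguments of [f] and of [fstar f] are inverse
    to each other, and [fstar f t = t * f t^-1] absorbs the Jacobian. *)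
Lemma integrand_grad x : divergence_integrand (fstar f) phi x =
  (divergence_integrand f (dual phi) (grad psi x) * (\det (Hess psi x))%:E)%E.
Proof.
set y := grad psi x; set a := \det (Hess psi x).
have a0 : 0 < a := Hess_det_gt0 x.
have Uy : U y := grad_interior sc gs cpsi x.
have aE : \det (Hess conj y) = a^-1.
  have aN0 : a != 0 by rewrite gt_eqF.
  by apply: (mulfI aN0); rewrite -det_mulmx Hess_mul det1 divff.
have dE : dual phi y = expR (psi x - dot y x) := dual_grad sc gs x.
pose t := expR (psi x + psi x - dot y x) * a.
have t0 : 0 < t by rewrite mulr_gt0// expR_gt0.
rewrite /divergence_integrand.
have -> : expR (dot (grad phi x) x / phi x) / phi x ^+ 2 *
    \det (Hess (fun z => - ln (phi z)) x) = t.
  rewrite dot_log_grad => [|i]; last by rewrite ln_phi; exact: gradE.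
  rewrite ln_phi -/y -/a /t /phi expr2 -expRD -expRN -expRD.
  by congr (expR _ * _); ring.
have -> : expR (dot (grad (dual phi) y) y / dual phi y) / dual phi y ^+ 2 *
    \det (Hess (fun z => - ln (dual phi z)) y) = t^-1.
  rewrite dot_log_grad => [|i]; last exact: conj_gradE.
  rewrite -/conj aE grad_conj_gradK dE /t expr2 -expRD -expRN -expRD [RHS]invfM -expRN.
  by congr (expR _ * _); rewrite (dotC x); ring.
rewrite /ext0 t0 invr_gt0 t0 -!EFinM /fstar; congr (_%:E).
rewrite dE (_ : phi x * (t * f t^-1) = phi x * t * f t^-1); last by rewrite mulrA.
have -> : phi x * t = expR (psi x - dot y x) * a.
  by rewrite /phi /t mulrA -expRD; congr (expR _ * _); ring.
by rewrite mulrAC.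
Qed.

Hypothesis mdual : measurable_fun [set: 'rV[R]_n] (dual phi).
Hypothesis idual : lam.-integrable (supp (dual phi)) (divergence_integrand f (dual phi)).

(** The part of the support of the dual function outside its interior is
    negligible, and the change of variables [y = grad psi x] is applied to the
    positive and negative parts of the integrand. *)
Lemma divergence_dual : divergence f (dual phi) = divergence (fstar f) phi.
Proof.
have mD : measurable (supp (dual phi)).
  rewrite (_ : supp _ = dual phi @^-1` `]0, +oo[%classic); last first.
    by apply/seteqP; split => y /=; rewrite in_itv/= andbT.
  by rewrite -[X in measurable X]setTI; exact: mdual.
have oU : open U by exact: open_interior.
have mU : measurable U by exact: open_measurable_rV.
have bnd : lam (supp (dual phi) `\` U) = 0%E.
  apply: (@convex_boundary_null _ _ _ (grad psi 0)) => //.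
    by move=> x y t; exact: supp_dual_convex.
  exact: grad_interior.
rewrite /divergence (negligible_integral (measurableD mD mU) mD idual bnd).
rewrite setDD (setIidr (@interior_subset _ _)) supp_phi.
set I := divergence_integrand f (dual phi).
have mI : measurable_fun U I.
  by apply: measurable_funS (measurable_int _ idual) => //; exact: interior_subset.
have cov (F : 'rV[R]_n -> \bar R) : measurable_fun U F -> (forall y, U y -> (0 <= F y)%E) ->
    (\int[lam]_(y in U) F y = \int[lam]_x (F (grad psi x) * (\det (Hess psi x))%:E))%E.
  move=> mF F0.
  rewrite (@ge0_change_of_variables _ _ U (grad psi) (grad conj) (Hess psi) (Hess conj))//.
  - by apply: eq_integral => x _; rewrite gtr0_norm.
  - exact: grad_interior.
  - exact: grad_conj_gradK.
  - exact: grad_grad_conjK.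
  - by move=> x; exact: C2_on_grad_strict C2psi (all_interior x).
  - by move=> y; exact: C2_on_grad_strict C2conj.
  - by move=> x; exact: C2_on_det_continuous C2psi (all_interior x).
have IE : divergence_integrand (fstar f) phi =
    (fun x => I (grad psi x) * (\det (Hess psi x))%:E)%E.
  by apply/funext => x; exact: integrand_grad.
have covp := cov _ (measurable_funepos mI) (fun y _ => funepos_ge0 I y).
have covn := cov _ (measurable_funeneg mI) (fun y _ => funeneg_ge0 I y).
rewrite IE (integralE _ U) covp covn [RHS]integralE; congr (_ - _)%E.
  apply: eq_integral => x _; rewrite !funeposE.
  rewrite maxe_pMl ?mul0e//.
  by rewrite lee_fin ltW.
apply: eq_integral => x _; rewrite !funenegE maxe_pMl ?mul0e ?mulNe//.
by rewrite lee_fin ltW.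
Qed.

End duality.

Theorem theorem3 (R : realType) (n : nat) (f : R -> R) (phi : 'rV[R]_n -> R)
  (hf : convex_pos f \/ concave_pos f)
  (hphi : log_concave phi)
  (hstrict : strictly_convex (fun x => - ln (phi x)))
  (hint : (lebesgue_rV R n).-integrable [set: 'rV[R]_n] (fun x => (phi x)%:E))
  (hint_dual : (lebesgue_rV R n).-integrable [set: 'rV[R]_n]
     (fun x => (dual phi x)%:E))
  (hC2 : C2_on (supp phi) phi)
  (hC2_dual : C2_on (supp (dual phi)) (dual phi))
  (hdiv : (lebesgue_rV R n).-integrable (supp phi)
     (divergence_integrand (fstar f) phi))
  (hdiv_dual : (lebesgue_rV R n).-integrable (supp (dual phi))
     (divergence_integrand f (dual phi))) :
  divergence f (dual phi) = divergence (fstar f) phi.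
Proof.
have [psi _ phiE] := hphi; subst phi.
have sc : strictly_convex psi.
  rewrite (_ : psi = fun x => - ln (expR (- psi x)))//.
  by apply/funext => x; rewrite expRK opprK.
have mdual := (measurable_EFinP _ _).1 (measurable_int _ hint_dual).
exact: (divergence_dual sc hC2 hC2_dual mdual hdiv_dual).
Qed.
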